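(* Let $p$ be a prime, let $G = \mathbb{F}_p^n$, and let $A \subset G \times G$ be a set of density $c > 0$, i.e. $|A| = c|G|^2$. Let $A^{(3)} \subset G \times G$ be the set obtained from $A$ by the three-step procedure defined in the context. Then $A^{(3)}$ contains $(U \times V) \cap \mathbf{B^L}$, where $U, V \leq G$ are subspaces and $\mathbf{B^L} \subset G \times G$ is a bilinear Bohr variety defined by bilinear maps, such that \[\operatorname{codim} U,\ \operatorname{codim} V,\ \operatorname{codim} \mathbf{B^L} \leq p^{\exp\left(\log^{O(1)} c^{-1}\right)}.\]
   Context: For $S \subset G \times G$ write $S_{x\cdot} = \{y \in G : (x,y) \in S\}$ and $S_{\cdot y} = \{x \in G : (x,y) \in S\}$. For sets $X, Y \subset G$, $X \pm Y$ denotes $\{x \pm y : x \in X, y \in Y\}$ (empty if $X$ or $Y$ is empty). Given $A \subset G \times G$, define \[A^{(1)} = \bigcup_{x \in G} \{x\} \times (A_{x\cdot} - A_{x\cdot}),\] \[A^{(2)} = \bigcup_{y \in G} \left(A^{(1)}_{\cdot y} + A^{(1)}_{\cdot y} - A^{(1)}_{\cdot y} - A^{(1)}_{\cdot y}\right) \times \{y\},\] \[A^{(3)} = \bigcup_{x \in G} \{x\} \times \left(A^{(2)}_{x\cdot} + A^{(2)}_{x\cdot} - A^{(2)}_{x\cdot} - A^{(2)}_{x\cdot}\right).\] Bilinear Bohr variety: a subset $B \subset G \times G$ is called a bilinear Bohr variety if there are a finite-dimensional $\mathbb{F}_p$-vector space $W$ and a biaffine map (affine in each variable) $\beta : G \times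 G \to W$ such that $B = \{(x,y) \in G \times G : \beta(x,y) = 0\}$. If $k = \dim W$, then $B$ is said to have codimension at most $k$, written $\operatorname{codim} B \leq k$. That $\mathbf{B^L}$ is defined by bilinear maps means that the defining map $\beta$ is bilinear; the bound on $\operatorname{codim} \mathbf{B^L}$ refers to the dimension of the target $W$ of such a map. For a subspace $U \leq G$, $\operatorname{codim} U = \dim G - \dim U$. The exponent $O(1)$ stands for a quantity bounded by an absolute constant, independent of $p$, $n$, $c$ and $A$; $\log^{O(1)} c^{-1}$ means $(\log c^{-1})^{O(1)}$. *)

(* Defs.v *)
From HB Require Import structures.
From mathcomp Require Import all_boot all_order all_algebra.
From mathcomp Require Import reals.
From mathcomp Require Import sequences exp.

Set Implicit Arguments.
Unset Strict Implicit.
Unset Printing Implicit Defensive.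

Import Order.TTheory GRing.Theory Num.Theory.

Local Open Scope ring_scope.

Section Steps.
Variable G : finZmodType.
Implicit Types (S : {set G * G}) (X Y : {set G}).

Definition setAdd X Y : {set G} := [set x + y | x in X, y in Y].
Definition setSub X Y : {set G} := [set x - y | x in X, y in Y].

(* X + X - X - X *)
Definition set2A2S X : {set G} := setSub (setSub (setAdd X X) X) X.

(* S_{x.} and S_{.y} *)
Definition fiber_fst S (x : G) : {set G} := [set y | (x, y) \in S].
Definition fiber_snd S (y : G) : {set G} := [set x | (x, y) \in S].

Definition step1 S : {set G * G} :=
  \bigcup_(x : G) setX [set x] (setSub (fiber_fst S x) (fiber_fst S x)).

Definition step2 S : {set G * G} :=
  \bigcup_(y : G) setX (set2A2S (fiber_snd (step1 S) y)) [set y].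

Definition step3 S : {set G * G} :=
  \bigcup_(x : G) setX [set x] (set2A2S (fiber_fst (step2 S) x)).

End Steps.

Definition affine (K : fieldType) (V W : lmodType K) (f : V -> W) : Prop :=
  linear (fun x => f x - f 0).

Definition biaffine (K : fieldType) (V W : lmodType K) (f : V -> V -> W) : Prop :=
  (forall x, affine (f x)) /\ (forall y, affine (fun x => f x y)).

(* B is the bilinear Bohr variety defined by beta; codim B is then at most
   \dim {:W}. *)
Definition bilinear_Bohr_variety (p n : nat) (W : vectType 'F_p)
    (beta : 'rV['F_p]_n -> 'rV['F_p]_n -> W)
    (B : {set 'rV['F_p]_n * 'rV['F_p]_n}) : Prop :=
  biaffine beta /\ B = [set xy | beta xy.1 xy.2 == 0].

(* Truncated subtraction is harmless since \dim U <= \dim {:V}. *)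
Definition codim (K : fieldType) (V : vectType K) (U : {vspace V}) : nat :=
  (\dim {:V} - \dim U)%N.

Definition vset (p n : nat) (U : {vspace 'rV['F_p]_n}) : {set 'rV['F_p]_n} :=
  [set x | x \in U].

(* Logarithm to base b > 1. *)
Definition log_base (R : realType) (b x : R) : R := ln x / ln b.

(* p ^ exp ((log c^-1) ^ K) with log to base b. With b a fixed constant the
   bound is a legitimate instance of p ^ exp (log ^ O(1) c^-1); the base is a
   parameter because for any prescribed base b0 the powers (log c^-1) ^ K all
   degenerate to 1 at c = 1 / b0, whatever K is. *)
Definition bohr_bound (R : realType) (b K : R) (p : nat) (c : R) : R :=
  p%:R `^ expR (log_base b c^-1 `^ K).

(* Main.v *)
(** Let [f_x] be the autocorrelation of the fibre [A_x], with Fourier transform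
    [|A_x^|^2 >= 0].  The function [h_x(y)], the average of
    [f_x1(y) f_x2(y) f_x3(y) f_x4(y)] over [x1 + x2 - x3 - x4 = x], is supported
    on the fibre of [A^(2)] at [x], so by Bogolyubov's argument the fibre of
    [A^(3)] at [x] contains every [y] orthogonal to the large spectrum of [h_x];
    a first use of the same argument gives the subspace [U] of those [x] for which
    [h_x] has large mean.  A large frequency of [h_x] is a popular value of
    [r1 + r2 - r3 - r4] with the points [(x_i, r_i)] in the set [S] of pairs
    [(x, r)] such that [A_x] has a large Fourier coefficient at [r].

    By Balog-Szemeredi-Gowers and Freiman, a set with bounded fibres and large
    additive energy meets the graph of some affine map often.  Removing such
    graphs greedily covers [S], up to a part of small energy, by [k] graphs.  For a
    quadruple of these graphs, [r1 + r2 - r3 - r4] is an affine function of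
    [(x1, x2, x3)], and a value attained with positive probability forces its
    linear part to have bounded rank; hence the large frequencies of [h_x] lie in
    [{L_1 x, ..., L_k x} + R] with [R] bounded.  Take [V] orthogonal to [R] and
    [beta(x, y) = (L_i x . y)_i].

    The double exponential bound leaves room for Ruzsa's elementary form of
    Freiman's theorem, which loses a factor [p^(poly(K))], so the exponent is
    [p^(poly(1/c))]. *)

Require Import Defs.
From HB Require Import structures.
From mathcomp Require Import all_boot all_order all_algebra.
From mathcomp Require Import reals.
From mathcomp Require Import sequences exp.
From mathcomp Require Import complex.
From mathcomp Require Import ring lra zify.

Set Implicit Arguments.
Unset Strict Implicit.
Unset Printing Implicit Defensive.

Import Order.TTheory GRing.Theory Num.Theory.

Local Open Scope ring_scope.

(** * Counting in finite abelian groups *)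

HB.instance Definition _ (G H : finZmodType) := GRing.Zmodule.on (G * H)%type.

(** Both sides expand into double sums, compared for each pair by [2xy <= x^2 + y^2] with
    [x = f i * g j] and [y = f j * g i]. *)
Lemma sum_CauchySchwarz_nat (I : finType) (f g : I -> nat) :
  ((\sum_i f i * g i) ^ 2 <= (\sum_i f i ^ 2) * (\sum_i g i ^ 2))%N.
Proof.
have E1 : ((\sum_i f i * g i) ^ 2 = \sum_i \sum_j (f i * g j) * (f j * g i))%N.
  rewrite expnS expn1 big_distrl /=; apply: eq_bigr => i _.
  by rewrite big_distrr /=; apply: eq_bigr => j _; lia.
have E2 : ((\sum_i f i ^ 2) * (\sum_i g i ^ 2) = \sum_i \sum_j (f i * g j) ^ 2)%N.
  rewrite big_distrl /=; apply: eq_bigr => i _.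
  by rewrite big_distrr /=; apply: eq_bigr => j _; rewrite expnMn.
have E3 : (\sum_i \sum_j (f i * g j) ^ 2 = \sum_i \sum_j (f j * g i) ^ 2)%N.
  by rewrite exchange_big.
rewrite -(leq_pmul2l (isT : (0 < 2)%N)) [leqRHS]mul2n -addnn {1}E2 E2 {2}E3 E1.
rewrite big_distrr -big_split /=; apply: leq_sum => i _.
rewrite big_distrr -big_split /=; apply: leq_sum => j _.
exact: nat_Cauchy.
Qed.

Lemma leq_card_setAdd (Z : finZmodType) (X Y : {set Z}) :
  (#|setAdd X Y| <= #|X| * #|Y|)%N.
Proof.
rewrite -cardsX; apply: leq_trans (leq_imset_card (fun u => u.1 + u.2) _).
apply/subset_leq_card/subsetP => z /imset2P[x y xX yY ->].
by apply/imsetP; exists (x, y); rewrite ?inE ?xX.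
Qed.

(** * Deciding identities in abelian groups *)

Section AbelianTactic.
Variable Z : zmodType.
Implicit Types a r u v x : Z.

Lemma zmod_swap a r u v : a = r + u -> a + v = r + v + u.
Proof. by move=> ->; rewrite addrAC. Qed.

Lemma zmod_cancelN a r x : a = r + x -> r = 0 -> a - x = 0.
Proof. by move=> -> ->; rewrite add0r subrr. Qed.

Lemma zmod_cancel a r x : a = r - x -> r = 0 -> a + x = 0.
Proof. by move=> -> ->; rewrite add0r addNr. Qed.

End AbelianTactic.

Ltac zmod_find eqt s u :=
  match s with
  | @Algebra.add _ ?a ?v => let _ := eqt v u in constr:(erefl s)
  | @Algebra.add _ ?a ?v => let h := zmod_find eqt a u in constr:(zmod_swap v h)
  | _ => let _ := eqt s u in constr:(esym (add0r s))
  end.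

Ltac zmod_findN eqt s x :=
  match s with
  | @Algebra.add _ ?a (@Algebra.opp _ ?v) => let _ := eqt v x in constr:(erefl s)
  | @Algebra.add _ ?a ?v => let h := zmod_findN eqt a x in constr:(zmod_swap v h)
  | @Algebra.opp _ ?v => let _ := eqt v x in constr:(esym (add0r s))
  end.

Ltac zmod_syntactic u v := match goal with _ => constr_eq u v end.
Ltac zmod_unify u v := match goal with _ => unify u v end.

(* Equal atoms may carry different canonical instances, hence the fallback. *)
Ltac zmod_cancels :=
  lazymatch goal with
  | |- @Algebra.add _ ?a (@Algebra.opp _ ?x) = _ =>
      let h := match goal with
        | _ => zmod_find zmod_syntactic a x
        | _ => zmod_find zmod_unify a x
        end in
      apply: (zmod_cancelN h); zmod_cancels
  | |- @Algebra.add _ ?a ?x = _ =>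
      let h := match goal with
        | _ => zmod_findN zmod_syntactic a x
        | _ => zmod_findN zmod_unify a x
        end in
      apply: (zmod_cancel h); zmod_cancels
  | |- _ => reflexivity
  end.

(* Decides identities in abelian groups by cancelling opposite terms. *)
Ltac zmod := apply/eqP; rewrite -subr_eq0; apply/eqP;
  rewrite ?(opprB, opprD, opprK, oppr0, addrA, add0r, addr0); zmod_cancels.

Lemma set2A2SP (G : finZmodType) (X : {set G}) a b c d :
  a \in X -> b \in X -> c \in X -> d \in X -> a + b - c - d \in set2A2S X.
Proof.
move=> aX bX cX dX; apply/imset2P; exists (a + b - c) d => //.
by apply/imset2P; exists (a + b) c => //; apply/imset2P; exists a b.
Qed.

Lemma sum_indic (T : finType) (S : {set T}) : (\sum_a (a \in S) = #|S|)%N.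
Proof. by rewrite -sum1_card [RHS]big_mkcond; apply: eq_bigr => a _; case: (a \in S). Qed.

Lemma sum_card_fibre (G : finZmodType) (A : {set G * G}) :
  (\sum_x #|fiber_fst A x| = #|A|)%N.
Proof.
transitivity (\sum_x \sum_y ((x, y) \in A : nat))%N.
  by apply: eq_bigr => x _; rewrite -sum_indic; apply: eq_bigr => y _; rewrite inE.
by rewrite pair_bigA /= -sum_indic; apply: eq_bigr => -[].
Qed.

(** * Representation counts and additive energy *)

Section Representations.
Variable Z : finZmodType.
Implicit Types (A B D X S : {set Z}) (d z : Z).

Definition rep A B d : nat := (\sum_a (a \in A) * ((a - d)%R \in B))%N.

Definition energy A : nat := (\sum_d rep A A d ^ 2)%N.

Lemma sum_indic_cond A (F : Z -> nat) :
  (\sum_(a in A) F a = \sum_a (a \in A) * F a)%N.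
Proof. by rewrite big_mkcond; apply: eq_bigr => a _; case: (a \in A); rewrite ?mul1n. Qed.

Lemma sum_shift (F : Z -> nat) z : (\sum_a F (a - z)%R = \sum_a F a)%N.
Proof.
by rewrite [RHS](reindex_inj (h := fun a : Z => (a - z)%R)) //; apply: addIr.
Qed.

Lemma sum_reflect (F : Z -> nat) z : (\sum_a F (z - a)%R = \sum_a F a)%N.
Proof.
by rewrite [RHS](reindex_inj (h := fun a : Z => (z - a)%R)) // => a b /addrI /oppr_inj.
Qed.

Lemma sum_rep A B : (\sum_d rep A B d = #|A| * #|B|)%N.
Proof.
rewrite exchange_big /= -sum_indic big_distrl /=; apply: eq_bigr => a _.
by rewrite -big_distrr /= (sum_reflect (fun b => nat_of_bool (b \in B))) sum_indic.
Qed.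

Lemma repC A d : rep A A (- d) = rep A A d.
Proof.
rewrite /rep -(sum_shift _ d); apply: eq_bigr => a _.
by rewrite opprK subrK mulnC.
Qed.

Lemma leq_rep A B d : (rep A B d <= #|A|)%N.
Proof.
by rewrite -sum_indic; apply: leq_sum => a _; case: (a \in A); case: (_ \in B).
Qed.

Lemma rep_diff A B d : (0 < rep A B d)%N -> d \in setSub A B.
Proof.
rewrite lt0n sum_nat_eq0 negb_forall => /existsP[a] /=.
rewrite muln_eq0 !eqb0 negb_or !negbK => /andP[aA aB].
by apply/imset2P; exists a (a - d) => //; rewrite subKr.
Qed.

Lemma card_popular A B D s k :
  (forall d, d \in D -> s <= k * rep A B d)%N ->
  (#|D| * s <= k * (#|A| * #|B|))%N.
Proof.
move=> h; rewrite -sum_rep -sum_nat_const big_distrr /=.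
apply: (@leq_trans (\sum_(d in D) k * rep A B d)%N); first exact: leq_sum.
by rewrite [leqRHS](bigID (mem D)) /= leq_addr.
Qed.

(** Both sides count the solutions of [a - b = a' - b']; the right side groups them by
    [e = a - a' = b - b']. *)
Lemma sum_rep_sqr A B :
  (\sum_d rep A B d ^ 2 = \sum_e rep A A e * rep B B e)%N.
Proof.
transitivity (\sum_a \sum_a' \sum_b
  ((a \in A) * (a' \in A)) * ((b \in B) * ((a' - a + b)%R \in B)))%N.
  transitivity (\sum_d \sum_a \sum_a'
    ((a \in A) * ((a - d)%R \in B)) * ((a' \in A) * ((a' - d)%R \in B)))%N.
    apply: eq_bigr => d _; rewrite expnS expn1 big_distrl /=.
    by apply: eq_bigr => a _; rewrite big_distrr.
  rewrite exchange_big /=; apply: eq_bigr => a _.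
  rewrite exchange_big /=; apply: eq_bigr => a' _.
  rewrite -(sum_reflect _ a); apply: eq_bigr => b _.
  rewrite subKr opprB addrCA addrC -addrA (addrC _ b) addrA -!mulnA; congr (_ * _)%N.
  by rewrite mulnCA addrAC.
symmetry.
transitivity (\sum_e \sum_a \sum_b
    ((a \in A) * ((a - e)%R \in A)) * ((b \in B) * ((b - e)%R \in B)))%N.
  apply: eq_bigr => e _; rewrite big_distrl /=.
  by apply: eq_bigr => a _; rewrite big_distrr.
rewrite exchange_big /=; apply: eq_bigr => a _.
rewrite -(sum_reflect _ a); apply: eq_bigr => a' _; apply: eq_bigr => b _.
by rewrite subKr opprB (addrC b).
Qed.

Lemma energy_le A : (energy A <= #|A| ^ 3)%N.
Proof.
rewrite expnSr [leqRHS]mulnC -mulnn -sum_rep big_distrr /=.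
by apply: leq_sum => d _; rewrite expnS expn1 leq_mul2r leq_rep orbT.
Qed.

(** The number of quadruples with [z1 + z2 - z3 - z4 = z], the fourth point being solved for. *)
Definition quads S1 S2 S3 S4 z : nat :=
  (\sum_z1 \sum_z2 \sum_z3
    (z1 \in S1) * (z2 \in S2) * (z3 \in S3) * ((z1 + z2 - z3 - z)%R \in S4))%N.

Lemma quadsE S1 S2 S3 S4 z : quads S1 S2 S3 S4 z =
  (\sum_(u : Z * Z * Z) (u.1.1 \in S1) * (u.1.2 \in S2) * (u.2 \in S3) *
     ((u.1.1 + u.1.2 - u.2 - z)%R \in S4))%N.
Proof.
rewrite /quads pair_bigA /=.
by rewrite (pair_bigA _ (fun (u : Z * Z) z3 => ((u.1 \in S1) * (u.2 \in S2) *
  (z3 \in S3) * ((u.1 + u.2 - z3 - z)%R \in S4))%N)).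
Qed.

(** Grouping by [d = z1 - z3] gives a sum of products of two representation counts; one use of
    Cauchy-Schwarz separates them, a second one, after [sum_rep_sqr], brings in the energies. *)
Lemma quads_energy S1 S2 S3 S4 z :
  (quads S1 S2 S3 S4 z ^ 4
     <= energy S1 * energy S2 * energy S3 * energy S4)%N.
Proof.
have E : quads S1 S2 S3 S4 z = (\sum_d rep S1 S3 d * rep S4 S2 (d - z)%R)%N.
  transitivity (\sum_d \sum_z1 \sum_z2
     ((z1 \in S1) * ((z1 - d)%R \in S3)) * (((z2 + (d - z))%R \in S4) * (z2 \in S2)))%N.
    rewrite exchange_big /=; apply: eq_bigr => z1 _.
    rewrite [RHS]exchange_big /=; apply: eq_bigr => z2 _.
    rewrite -[RHS](sum_reflect _ z1); apply: eq_bigr => z3 _.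
    have -> : z2 + (z1 - z3 - z) = z1 + z2 - z3 - z by zmod.
    by rewrite subKr; lia.
  apply: eq_bigr => d _; rewrite big_distrl /=; apply: eq_bigr => z1 _.
  rewrite [RHS]big_distrr /= -[LHS](sum_shift _ (d - z)); apply: eq_bigr => a _.
  by rewrite subrK.
have CS A B : ((\sum_d rep A B d ^ 2) ^ 2 <= energy A * energy B)%N.
  by rewrite sum_rep_sqr; apply: sum_CauchySchwarz_nat.
rewrite E (expnM _ 2 2).
apply: leq_trans (_ : ((\sum_d rep S1 S3 d ^ 2) * (\sum_d rep S4 S2 d ^ 2)) ^ 2 <= _)%N.
  rewrite leq_exp2r // -(sum_shift (fun d => rep S4 S2 d ^ 2)%N z).
  exact: sum_CauchySchwarz_nat.
rewrite expnMn [leqRHS](_ : _ = energy S1 * energy S3 * (energy S4 * energy S2))%N.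
  exact: leq_mul.
by rewrite -!mulnA; congr (_ * _)%N; rewrite mulnCA; congr (_ * _)%N; rewrite mulnC.
Qed.
End Representations.

(** * Balog-Szemeredi-Gowers and Freiman over F_p *)

Section BalogSzemerediGowers.
Variable Z : finZmodType.
Implicit Types (A B D X P U : {set Z}).

Lemma sum_fibres_energy A :
  (\sum_s #|[set a in A | (a - s)%R \in A]| ^ 2 = energy A)%N.
Proof.
apply: eq_bigr => s _; congr (_ ^ 2)%N; rewrite -sum_indic; apply: eq_bigr => a _.
by rewrite inE mulnb.
Qed.

(* Schoen's argument: for a random s, most pairs in A n (A + s) have a popular
   difference, so pairs of typical elements have many representations as a
   difference of two popular differences. *)
Lemma balog_szemeredi_gowers A K :
  (0 < #|A|)%N -> (#|A| ^ 3 <= K * energy A)%N ->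
  exists2 X : {set Z}, X \subset A &
    (#|A| <= 4 * K * #|X|)%N /\ (#|setSub X X| <= 2 ^ 14 * K ^ 4 * #|X|)%N.
Proof.
move=> A0 hE.
have K0 : (0 < K)%N.
  by case: K hE => //; rewrite mul0n leqNgt expn_gt0 A0.
pose bad a b := (32 * K * rep A A (a - b)%R < #|A|)%N.
pose X s := [set a in A | a - s \in A].
pose Bad s := (\sum_(a in X s) #|[set b in X s | bad a b]|)%N.
have BadE s : Bad s = (\sum_a \sum_b ((a \in A) * (b \in A) * bad a b) *
    (((a - s)%R \in A) * ((b - s)%R \in A)))%N.
  rewrite /Bad sum_indic_cond; apply: eq_bigr => a _.
  rewrite -sum_indic big_distrr /=; apply: eq_bigr => b _.
  by rewrite !inE; case: (a \in A); case: (a - s \in A); case: (b \in A);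
     case: (b - s \in A); case: (bad a b).
(* A pair [(a, b)] of [A] lies in [X s] for exactly [rep A A (a - b)] shifts [s], fewer than
   [|A| / (32 K)] if the pair is bad. *)
have sumBad : (32 * K * \sum_s Bad s <= #|A| ^ 3)%N.
  rewrite (eq_bigr _ (fun s _ => BadE s)) exchange_big /=.
  rewrite (_ : #|A| ^ 3 = \sum_a \sum_b (a \in A) * (b \in A) * #|A|)%N; last first.
    rewrite expnSr -mulnn -{1 2}sum_indic !big_distrl /=; apply: eq_bigr => a _.
    by rewrite -mulnA big_distrl big_distrr /=; apply: eq_bigr => b _; rewrite mulnA.
  rewrite big_distrr; apply: leq_sum => a _ /=.
  rewrite exchange_big big_distrr; apply: leq_sum => b _ /=.
  rewrite -big_distrr /= (_ : \sum_s _ = rep A A (a - b)%R)%N; last first.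
    rewrite -(sum_reflect _ a); apply: eq_bigr => u _.
    by rewrite subKr (_ : b - (a - u) = u - (a - b)) //; zmod.
  case: (a \in A) => //; case: (b \in A); rewrite ?muln0 //=.
  by case h: (bad a b); rewrite ?muln0 //= !mul1n; apply: ltnW.
(* If every [s] failed, the small [X s] would add at most [|A|^3] to [2 K energy A], and the others
   at most [16 K] times the sum of [Bad], hence at most [|A|^3 / 2]; but the total is at least
   [2 |A|^3]. *)
have [s /andP[Xbig Bsmall]] :
    exists s, (#|A| <= 2 * K * #|X s|)%N && (8 * Bad s <= #|X s| ^ 2)%N.
  apply/existsP; apply/negbNE/negP; rewrite negb_exists => /forallP hs.
  have : (2 * K * energy A <= #|A| ^ 3 + 16 * K * \sum_s Bad s)%N.
    rewrite -sum_fibres_energy expnSr -mulnn -sum_rep !(big_distrl, big_distrr) /=.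
    rewrite -big_split; apply: leq_sum => t _ /=.
    have -> : rep A A t = #|X t|.
      by rewrite -sum_indic; apply: eq_bigr => a _; rewrite inE mulnb.
    have := hs t; rewrite negb_and -!ltnNge => /orP[h|h].
      apply: leq_trans (leq_addr _ _); rewrite -/(X t) -mulnn mulnA mulnC leq_mul2l.
      by rewrite (ltnW h) orbT.
    apply: leq_trans (leq_addl _ _); rewrite -/(X t).
    rewrite (_ : 16 * K * Bad t = 2 * K * (8 * Bad t))%N; last by lia.
    by rewrite leq_mul2l (ltnW h) orbT.
  have A3 : (0 < #|A| ^ 3)%N by rewrite expn_gt0 A0.
  by move: sumBad hE A3; nia.
have X0 : (0 < #|X s|)%N by case: #|X s| Xbig => //; lia.
(* By Markov's inequality this keeps at least half of [X s]. *)
pose X' := [set a in X s | 4 * #|[set b in X s | bad a b]| <= #|X s|]%N.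
have X'X : X' \subset X s by apply/subsetP => a; rewrite inE => /andP[].
have cX' : (#|X s| <= 2 * #|X'|)%N.
  have : (#|X s :\: X'| * #|X s| <= 4 * Bad s)%N.
    rewrite -sum_nat_const /Bad big_distrr /= [leqRHS](big_setID X') /=.
    apply: leq_trans (leq_addl _ _); apply: leq_sum => a.
    by rewrite !inE => /andP[]; rewrite negb_and -ltnNge => /orP[/negbTE->//|/ltnW].
  by have := cardsID X' (X s); rewrite (setIidPr X'X); nia.
exists X'; first by apply: subset_trans X'X _; apply/subsetP => a; rewrite inE => /andP[].
split; first by nia.
pose conv d := (\sum_e rep A A e * rep A A (e - d)%R)%N.
(* At least half of the [b] in [X s] are good for both [a] and [a']; each gives a term [e = a - b]
   with both factors of [conv] large, as [e - d = a' - b]. *)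
have convD d : d \in setSub X' X' -> (#|X s| * #|A| ^ 2 <= 2 * (32 * K) ^ 2 * conv d)%N.
  case/imset2P => a a'; rewrite !inE => /andP[aX ha] /andP[a'X ha'] ->.
  pose Y := [set b in X s | ~~ bad a b && ~~ bad a' b].
  have cY : (#|X s| <= 2 * #|Y|)%N.
    have : (#|X s| <= #|Y| + (#|[set b in X s | bad a b]| + #|[set b in X s | bad a' b]|))%N.
      rewrite -!sum_indic -!big_split /=; apply: leq_sum => b _.
      by rewrite !inE; case: (_ && _); case: (bad a b); case: (bad a' b).
    by move: ha ha'; lia.
  have : (#|Y| * #|A| ^ 2 <= (32 * K) ^ 2 * conv (a - a')%R)%N.
    rewrite /conv -(sum_reflect _ a) -sum_nat_const big_distrr /=.
    rewrite [leqRHS](bigID (mem Y)) /=; apply: leq_trans (leq_addr _ _).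
    apply: leq_sum => b; rewrite inE => /andP[_ /andP[]]; rewrite /bad -!leqNgt.
    rewrite (_ : a - b - (a - a') = a' - b); last by zmod.
    move=> h1 h2; rewrite -mulnn; apply: leq_trans (leq_mul h1 h2) _.
    by rewrite -mulnn mulnACA.
  by nia.
have sconv : (\sum_d conv d = #|A| ^ 4)%N.
  rewrite exchange_big /= (expnD _ 2 2) -mulnn -sum_rep big_distrl /=.
  by apply: eq_bigr => e _; rewrite -big_distrr /= sum_reflect.
have : (#|setSub X' X'| * (#|X s| * #|A| ^ 2) <= 2 * (32 * K) ^ 2 * #|A| ^ 4)%N.
  rewrite -sconv -sum_nat_const big_distrr /= [leqRHS](bigID (mem (setSub X' X'))) /=.
  by apply: leq_trans (leq_addr _ _); apply: leq_sum => d; apply: convD.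
rewrite (expnD _ 2 2) mulnA [leqRHS]mulnA leq_pmul2r ?expn_gt0 ?A0 // => h.
rewrite -(leq_pmul2r X0); apply: leq_trans h _.
apply: (@leq_trans (2 * (32 * K) ^ 2 * (2 * K * #|X s|) ^ 2)%N).
  by rewrite leq_mul2l leq_sqr Xbig orbT.
rewrite (_ : 2 * _ * _ = 2 ^ 13 * K ^ 4 * #|X s| * #|X s|)%N; last first.
  rewrite !expnMn; lia.
by rewrite leq_mul2r; apply/orP; right; nia.
Qed.

End BalogSzemerediGowers.

Section PopularDifferences.
Variable Z : finZmodType.
Implicit Types (A B D X P U : {set Z}).

(** A variant of Ruzsa's triangle inequality: each representation of [d] as a difference in [X]
    yields one of [u - a + d] as a difference of an element of [U - X] and one of [X - X]. *)
Lemma leq_card_sub_add U X P s k :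
  (forall d, d \in P -> s <= k * rep X X d)%N ->
  (#|setAdd (setSub U X) P| * s <= k * (#|setSub U X| * #|setSub X X|))%N.
Proof.
move=> hP; apply: card_popular => w /imset2P[_ d /imset2P[u a uU aX ->] dP ->].
apply: leq_trans (hP d dP) _; rewrite leq_mul2l; apply/orP; right.
(* [u - a + d = (u - (x - d)) - (a - x)] for each [x, x - d] in [X]. *)
rewrite /rep -[leqLHS](sum_shift _ (- d)) -[leqRHS](sum_reflect _ u).
apply: leq_sum => x _; rewrite opprK addrK.
rewrite (_ : u - x - (u - a + d) = a - (x + d)); last by zmod.
case xX: (x \in X); rewrite ?muln0 // muln1; case x'X: (x + d \in X) => //=.
rewrite (_ : u - x \in _); last by apply/imset2P; exists u x.
by rewrite (_ : a - (x + d) \in _) //; apply/imset2P; exists a (x + d).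
Qed.

(* P is the set of popular differences of X: unlike X itself, it has small
   iterated sumsets without any appeal to Pluennecke's inequality. *)
Lemma popular_differences X L :
    (0 < #|X|)%N -> (#|setSub X X| <= L * #|X|)%N ->
  exists P : {set Z},
    [/\ 0 \in P, (forall d, d \in P -> - d \in P),
        (#|setAdd (setAdd (setAdd P P) P) P| <= 16 * L ^ 7 * #|P|)%N,
        (#|P| <= L * #|X|)%N &
        exists2 b, b \in X & (#|X| <= 2 * #|[set a in X | (a - b)%R \in P]|)%N].
Proof.
move=> X0 hX; pose P := [set d | #|X| <= 2 * L * rep X X d]%N.
have L0 : (0 < L)%N.
  case: L hX {P} => //; rewrite mul0n leqNgt => /negP[]; case/card_gt0P: X0 => x xX.
  by apply/card_gt0P; exists (x - x); apply/imset2P; exists x x.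
have PX : P \subset setSub X X.
  apply/subsetP => d; rewrite inE => h; apply: rep_diff.
  by case: (rep X X d) h X0; rewrite // muln0; case: #|X|.
have cP : (#|P| <= L * #|X|)%N := leq_trans (subset_leq_card PX) hX.
(* Unpopular differences account for at most [L |X| * |X| / (2 L)], half of all pairs of [X], so
   some [b] sees half of [X] at a popular difference. *)
have hb : exists2 b, b \in X & (#|X| <= 2 * #|[set a in X | (a - b)%R \in P]|)%N.
  apply/exists_inP; apply/negbNE/negP; rewrite negb_exists_in => /forall_inP hb.
  have e1 : (\sum_(b in X) #|[set a in X | (a - b)%R \in P]| = \sum_(d in P) rep X X d)%N.
    rewrite !sum_indic_cond.
    transitivity (\sum_b \sum_a (b \in X) * ((a \in X) * ((a - b)%R \in P)))%N.
      apply: eq_bigr => b _; rewrite -sum_indic big_distrr; apply: eq_bigr => a _ /=.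
      by rewrite !inE; do 2!case: (_ \in X); case: (_ <= _)%N.
    rewrite exchange_big /=.
    transitivity (\sum_d \sum_a (d \in P) * ((a \in X) * ((a - d)%R \in X)))%N.
      rewrite [RHS]exchange_big /=; apply: eq_bigr => a _.
      rewrite -[LHS](sum_reflect _ a); apply: eq_bigr => d _.
      by rewrite subKr; lia.
    by apply: eq_bigr => d _; rewrite big_distrr.
  have e2 : (2 * \sum_(d in P) rep X X d < #|X| * #|X|)%N.
    rewrite -e1 -sum_nat_const big_distrr /=.
    have /card_gt0P[x xX] := X0.
    rewrite (big_setD1 x) //= [ltnRHS](big_setD1 x) //= -addSn leq_add //.
      by rewrite ltnNge hb.
    by apply: leq_sum => b /setD1P[_ bX]; rewrite ltnW // ltnNge hb.
  have e3 : (2 * L * \sum_(d | d \notin P) rep X X d <= L * (#|X| * #|X|))%N.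
    apply: (@leq_trans (\sum_(d in setSub X X) #|X|)%N); last first.
      by rewrite sum_nat_const mulnA leq_mul2r hX orbT.
    rewrite big_distrr sum_indic_cond [leqRHS](bigID (mem P)) /=.
    apply: leq_trans (leq_addl _ _); apply: leq_sum => d.
    rewrite inE -ltnNge => h; case: (posnP (rep X X d)) => [->|r0]; first by rewrite muln0.
    by rewrite (rep_diff r0) mul1n ltnW.
  move: e3; rewrite (mulnC 2%N) -mulnA leq_pmul2l // leqNgt => /negP[].
  move: e2; rewrite -sum_rep [\sum_d _](bigID (mem P)) /=.
  by rewrite !mul2n -!addnn ltn_add2l ltn_add2r.
have hcard : (#|X| <= 2 * #|P|)%N.
  case: hb => b bX /leq_trans; apply; rewrite leq_mul2l /=.
  rewrite -(card_imset _ (addIr (- b))); apply/subset_leq_card/subsetP => z.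
  by case/imsetP => a; rewrite inE => /andP[_ aP] ->.
(* Each summand [P] costs a factor [2 L^2] in the bound for [U - X]. *)
have step U c : (#|setSub U X| <= c * #|X|)%N ->
    (#|setSub (setAdd U P) X| <= 2 * L ^ 2 * c * #|X|)%N.
  move=> hU; have -> : setSub (setAdd U P) X = setAdd (setSub U X) P.
    apply/setP => z; apply/imset2P/imset2P.
      move=> [_ x /imset2P[u d uU dP ->] xX ->]; exists (u - x) d => //; last by zmod.
      by apply/imset2P; exists u x.
    move=> [_ d /imset2P[u x uU xX ->] dP ->]; exists (u + d) x => //; last by zmod.
    by apply/imset2P; exists u d.
  rewrite -(leq_pmul2r X0).
  apply: leq_trans (@leq_card_sub_add U X P #|X| (2 * L)%N _) _.
    by move=> d; rewrite inE.
  apply: leq_trans (_ : 2 * L * ((c * #|X|) * (L * #|X|)) <= _)%N.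
    by rewrite leq_mul2l leq_mul ?orbT.
  by rewrite -mulnn leq_eqVlt; apply/orP; left; apply/eqP; lia.
exists P; split => //.
- rewrite inE; have -> : rep X X 0 = #|X|.
    by rewrite -sum_indic; apply: eq_bigr => a _; rewrite subr0; case: (a \in X).
  by rewrite -{1}(mul1n #|X|) leq_mul2r muln_gt0 L0 orbT.
- by move=> d; rewrite !inE repC.
(* Three summands give [(2 L^2)^3 L = 8 L^7]; the fourth [P] is absorbed by its inclusion in
   [X - X], and [|X| <= 2 |P|] doubles the constant. *)
have h3 := step _ _ (step _ _ (step _ _ hX)).
apply: (@leq_trans #|setSub (setAdd (setAdd (setAdd X P) P) P) X|).
  apply: subset_leq_card; apply/subsetP => z.
  move=> /imset2P[_ p4 /imset2P[_ p3 /imset2P[p1 p2 p1P p2P ->] p3P ->] p4P ->].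
  have /imset2P[x y xX yX ->] := subsetP PX _ p1P.
  apply/imset2P; exists (x + p2 + p3 + p4) y => //; last by zmod.
  by do 3!(apply/imset2P; (eexists; last by []); last by []) .
apply: leq_trans h3 _.
apply: (@leq_trans (8 * L ^ 7 * (2 * #|P|))%N); last by rewrite mulnA (mulnAC 8); lia.
rewrite (_ : 2 * _ * _ = 8 * L ^ 7)%N ?leq_mul2l ?hcard ?orbT //.
by rewrite !expnS expn0; lia.
Qed.

(* Ruzsa covering: T is a maximal set of t in P + P + P with disjoint P + t. *)
Lemma ruzsa_covering P m :
    0 \in P -> (forall d, d \in P -> - d \in P) ->
    (#|setAdd (setAdd (setAdd P P) P) P| <= m * #|P|)%N ->
  exists2 T : {set Z}, (#|T| <= m)%N &
    setAdd (setAdd P P) P \subset setAdd T (setAdd P P).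
Proof.
move=> P0 PN hP; set P3 := setAdd (setAdd P P) P in hP *.
pose sep (T : {set Z}) := (T \subset P3) &&
  [forall t in T, forall t' in T, forall d in P, forall d' in P,
     (t + d == t' + d') ==> (t == t')].
have sep0 : sep set0.
  by rewrite /sep sub0set; apply/forall_inP => t; rewrite inE.
have [T /maxsetP[/andP[TP3 sepT] maxT] _] := maxset_exists sep0.
exists T.
  have P_gt0 : (0 < #|P|)%N by apply/card_gt0P; exists 0.
  rewrite -(leq_pmul2r P_gt0); apply: leq_trans hP; rewrite -cardsX.
  rewrite -(card_in_imset (f := fun u : Z * Z => u.1 + u.2)).
    apply/subset_leq_card/subsetP => z /imsetP[[t d] /setXP[tT dP] ->].
    by apply/imset2P; exists t d => //; apply: (subsetP TP3).
  move=> [t d] [t' d'] /setXP[/= tT dP] /setXP[/= t'T d'P] e.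
  move/forall_inP/(_ t tT)/forall_inP/(_ t' t'T)/forall_inP/(_ d dP) in sepT.
  move/forall_inP/(_ d' d'P) in sepT; move: sepT; rewrite e eqxx => /eqP tt.
  by move: e; rewrite tt => /addrI ->.
apply/subsetP => z zP3.
have P2 d d' : d \in P -> d' \in P -> d + d' \in setAdd P P.
  by move=> dP d'P; apply/imset2P; exists d d'.
have [zT|zT] := boolP (z \in T).
  by apply/imset2P; exists z (0 + 0); rewrite ?P2 ?addr0.
have /negP nsep : ~~ sep (z |: T).
  apply/negP => /maxT /(_ (subsetUr _ _)) e; case/negP: zT; rewrite -e.
  by rewrite !inE eqxx.
apply: contraT => nz; case: nsep; apply/andP; split; first by rewrite subUset sub1set zP3.
(* If the translates of [P] by [z] and [t] met, [z] would lie in [t + P + P]. *)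
have key t d d' : t \in T -> d \in P -> d' \in P -> z + d <> t + d'.
  move=> tT dP d'P e; move/negP: nz; apply; apply/imset2P; exists t (d' - d) => //.
    by apply: P2 => //; apply: PN.
  by rewrite addrA -e addrK.
apply/forall_inP => t; rewrite !inE => ht.
apply/forall_inP => t'; rewrite !inE => ht'.
apply/forall_inP => d dP; apply/forall_inP => d' d'P; apply/implyP => /eqP e.
case/predU1P: ht ht' e => [->|tT] /predU1P[->|t'T] e //.
- by case: (key t' d d').
- by case: (key t d' d).
move/forall_inP/(_ t tT)/forall_inP/(_ t' t'T)/forall_inP/(_ d dP) in sepT.
by move/forall_inP/(_ d' d'P) in sepT; move: sepT; rewrite e eqxx.
Qed.

End PopularDifferences.

Section GraphAgreement.
Variables (p n : nat).
Hypothesis p_prime : prime p.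
Local Notation E := 'rV['F_p]_n.
Local Notation Z := (E * E)%type.
Implicit Types (P S T : {set Z}) (x y k : E) (Q K : nat).

Lemma card_span T : (#|[set v | v \in <<enum T>>%VS]| <= p ^ #|T|)%N.
Proof.
pose X := in_tuple (enum T).
pose f (c : {ffun 'I_(size (enum T)) -> 'F_p}) : Z := \sum_i c i *: X`_i.
apply: (@leq_trans #|f @: [set: _]|).
  apply/subset_leq_card/subsetP => v; rewrite inE => /(coord_span (X := X)) ->.
  apply/imsetP; exists [ffun i => coord X i v]; rewrite ?inE //.
  by apply: eq_bigr => i _; rewrite ffunE.
apply: leq_trans (leq_imset_card _ _) _.
by rewrite cardsT card_ffun card_Fp // card_ord -cardE.
Qed.

(** The set [H], the span of [T] plus [P + P], is stable under adding elements of [P], so it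
    contains the span of [P]. *)
Lemma card_span_covering P T :
    setAdd (setAdd P P) P \subset setAdd T (setAdd P P) -> 0 \in P ->
  (#|[set v | v \in <<enum P>>%VS]| <= p ^ #|T| * #|setAdd P P|)%N.
Proof.
move=> /subsetP cov P0.
pose H := setAdd [set v | v \in <<enum T>>%VS] (setAdd P P).
have H0 : 0 \in H.
  apply/imset2P; exists 0 (0 + 0); rewrite ?addr0 ?inE ?mem0v //.
  by apply/imset2P; exists 0 0; rewrite ?addr0.
have HP z d : z \in H -> d \in P -> z + d \in H.
  case/imset2P => l e; rewrite inE => lT eP2 -> dP; rewrite -addrA.
  have /cov/imset2P[t e' tT e'P2 ->] : e + d \in setAdd (setAdd P P) P.
    by apply/imset2P; exists e d.
  rewrite addrA; apply/imset2P; exists (l + t) e' => //.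
  by rewrite inE rpredD // memv_span // mem_enum.
apply: (@leq_trans #|H|); last first.
  by apply: leq_trans (leq_card_setAdd _ _) _; rewrite leq_mul2r card_span orbT.
apply/subset_leq_card/subsetP => v; rewrite inE => /(coord_span (X := in_tuple _)) ->.
pose stable u := forall z, z \in H -> z + u \in H.
suff st : stable (\sum_i coord (in_tuple (enum P)) i v *: (in_tuple (enum P))`_i).
  by rewrite -[X in X \in H]add0r; apply: st.
apply: (big_ind stable) => [z zH | u w hu hw z zH | i _].
- by rewrite addr0.
- by rewrite addrA; apply/hw/hu.
have xP : (in_tuple (enum P))`_i \in P by rewrite -mem_enum mem_nth.
(* Scalars of ['F_p] act as repeated addition. *)
rewrite -[coord _ i v]natr_Zp scaler_nat.
elim: (nat_of_ord (coord _ i v)) => [|j IH] z zH; first by rewrite mulr0n addr0.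
by rewrite mulrS addrA; apply/IH/HP.
Qed.

(* A subspace of E * E is a union of translates, by its vertical part, of the
   graph of a linear map; one of them meets S often. *)
Lemma graph_pigeonhole (H : {vspace Z}) S :
    (forall z, z \in S -> z \in H) ->
  exists M : 'M['F_p]_n, exists k : E,
    (#|S| * #|fst @: S| <= #|[set z | z \in H]| * #|[set x | (x, x *m M + k)%R \in S]|)%N.
Proof.
move=> SH; pose pi := linfun (@fst E E) : 'Hom(Z, E).
(* [sec] is a linear section, with values in [H], over the first coordinates of [H]; its second
   coordinate is the matrix [M]. *)
pose g := (pi \o projv H)%VF.
pose sec u := projv H (g^-1%VF u).
have secH u : sec u \in H by exact: memv_proj.
have sec1 h : h \in H -> (sec h.1).1 = h.1.
  move=> hH; have e : h.1 = g h by rewrite comp_lfunE projv_id // lfunE.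
  have im : h.1 \in limg g by rewrite e memv_img ?memvf.
  by rewrite -[RHS](limg_lfunVK im) comp_lfunE lfunE.
pose M := lin1_mx (snd \o (projv H \o g^-1%VF)).
have secM u : u *m M = (sec u).2 by rewrite mul_rV_lin1.
pose Ker := [set k : E | (0, k) \in H].
have secE h : h \in H -> sec h.1 = (h.1, h.1 *m M).
  by move=> hH; rewrite secM -{2}(sec1 h hH); case: (sec h.1).
have KerP h : h \in H -> h.2 - h.1 *m M \in Ker.
  move=> hH; rewrite inE; have : h - sec h.1 \in H by rewrite rpredB.
  by rewrite secE //; case: h hH => a b /= _; rewrite /GRing.add /= /add_pair /= subrr.
(* [Ker] times the first coordinates of [S] embeds in [H] by [(k, u) -> (u, u M + k)]. *)
have cKer : (#|Ker| * #|fst @: S| <= #|[set z | z \in H]|)%N.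
  rewrite -cardsX -(card_in_imset (f := fun u => (u.2, u.2 *m M + u.1))).
    apply/subset_leq_card/subsetP => z /imsetP[[k u] /setXP[]].
    rewrite inE /= => kK /imsetP[h /SH hH ->] ->; rewrite inE.
    have -> : (h.1, h.1 *m M + k) = sec h.1 + (0, k).
      by rewrite secE // /GRing.add /= /add_pair /= addr0.
    by rewrite rpredD.
  by move=> [k u] [k' u'] _ _ [-> /addrI ->].
have cS : (#|S| <= \sum_(k in Ker) #|[set x | (x, x *m M + k)%R \in S]|)%N.
  rewrite -sum1_card (partition_big (fun h => h.2 - h.1 *m M) (mem Ker)) /=; last first.
    by move=> h /SH /KerP.
  apply: leq_sum => k _; rewrite sum1_card.
  rewrite -(card_in_imset (f := fst)); last first.
    move=> [a b] [a' b']; rewrite !unfold_in /= => /andP[_ /eqP e1] /andP[_ /eqP e2] e.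
    by subst a'; move: e2; rewrite -e1 => /addIr ->.
  apply/subset_leq_card/subsetP => x /imsetP[[a b]].
  by rewrite !inE unfold_in /= => /andP[abS /eqP <-] ->; rewrite addrC subrK.
exists M; case: (boolP [exists k in Ker, #|S| * #|fst @: S| <=
   #|[set z | z \in H]| * #|[set x | (x, x *m M + k)%R \in S]|]%N).
  by case/exists_inP => k _ hk; exists k.
(* Without a good [k], either [S] is empty and [0] serves, or adding up the failures over [Ker]
   contradicts [cKer]. *)
rewrite negb_exists_in => /forall_inP h; exists 0.
have [->|S0] := posnP #|S|; first by rewrite mul0n.
have K0 : 0 \in Ker by rewrite inE mem0v.
have : (#|[set z | z \in H]| * #|S| < #|Ker| * (#|S| * #|fst @: S|))%N.
  apply: leq_ltn_trans (leq_mul (leqnn _) cS) _.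
  rewrite -[ltnRHS]sum_nat_const big_distrr /= (big_setD1 0) //= [ltnRHS](big_setD1 0) //= -addSn.
  rewrite leq_add //; first by rewrite ltnNge h.
  by apply: leq_sum => k /setD1P[_ kK]; rewrite ltnW // ltnNge h.
by rewrite mulnCA mulnC ltn_pmul2l // ltnNge cKer.
Qed.

(** Losses in order: the doubling after Balog-Szemeredi-Gowers, the number of covering translates,
    and in [agree_const] the factors [k0] from [E] to [S], [4 K] from [S] to [X], and the rest from
    [X] to the graph. *)
Definition bsg_const K := (2 ^ 14 * K ^ 4)%N.
Definition cover_const K := (16 * bsg_const K ^ 7)%N.
Definition agree_const (k0 Q : nat) := let K := (Q ^ 3 * k0)%N in
  (k0 * (4 * K) * (4 * Q * cover_const K * bsg_const K) * p ^ cover_const K)%N.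

Lemma leq_card_fibres S Q :
  (forall x, #|[set y | (x, y) \in S]| <= Q)%N -> (#|S| <= Q * #|fst @: S|)%N.
Proof.
move=> hQ; rewrite mulnC -sum_nat_const -sum1_card.
rewrite (partition_big fst (mem (fst @: S))) /=; last by move=> z zS; apply: imset_f.
apply: leq_sum => x _; rewrite sum1_card; apply: leq_trans (hQ x).
rewrite -(card_in_imset (f := snd)); last first.
  move=> [a b] [a' b']; rewrite !unfold_in /= => /andP[_ /eqP->] /andP[_ /eqP->].
  by move=> ->.
apply/subset_leq_card/subsetP => y /imsetP[[a b]].
by rewrite !inE unfold_in /= => /andP[abS /eqP <-] ->.
Qed.

(** A large part of a set [X] of small doubling is translated into the span of its popular
    differences, which exceeds [|X|] by a bounded factor; bounded fibres make its first projection
    large, so [graph_pigeonhole] gives a graph meeting it often. *)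
Lemma affine_agreement S (k0 Q : nat) :
    (forall x, #|[set y | (x, y) \in S]| <= Q)%N ->
    (#|E| ^ 3 <= k0 * energy S)%N ->
  exists M : 'M['F_p]_n, exists v : E,
    (#|E| <= agree_const k0 Q * #|[set x | (x, x *m M + v)%R \in S]|)%N.
Proof.
move=> hQ hE; pose K := (Q ^ 3 * k0)%N.
have N0 : (0 < #|E|)%N by apply/card_gt0P; exists 0.
have cfst T : (#|fst @: T| <= #|E|)%N by apply: max_card.
(* Bounded fibres give [|S| <= Q |E|], so the energy is large relative to [|S|^3], with loss
   [Q^3 k0]. *)
have cS : (#|S| ^ 3 <= K * energy S)%N.
  apply: (@leq_trans ((Q * #|E|) ^ 3)%N).
    by rewrite leq_exp2r // (leq_trans (leq_card_fibres hQ)) // leq_mul2l cfst orbT.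
  by rewrite expnMn /K -mulnA leq_mul2l hE orbT.
have NS : (#|E| <= k0 * #|S|)%N.
  rewrite -(@leq_exp2r _ _ 3) //; apply: leq_trans hE _.
  apply: leq_trans (leq_mul (leqnn k0) (energy_le S)) _.
  rewrite expnMn leq_mul2r; apply/orP; right.
  by case: (k0) => // k1; rewrite -[leqLHS]expn1 leq_pexp2l.
have S0 : (0 < #|S|)%N by case: #|S| NS N0; rewrite // muln0; case: #|E|.
have [X XS [cX dX]] := balog_szemeredi_gowers S0 cS.
have X0 : (0 < #|X|)%N by case: #|X| cX S0; rewrite // muln0; case: #|S|.
have [P [P0 PN c4 cP [b bX cXb]]] := popular_differences X0 dX.
have [T cT cov] := ruzsa_covering P0 PN c4.
pose L := bsg_const K; pose m := cover_const K.
pose W := [set a - b | a in [set a in X | (a - b)%R \in P]].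
have cW : (#|X| <= 2 * #|W|)%N by rewrite card_imset //; apply: addIr.
pose H := <<enum P>>%VS.
have WH z : z \in W -> z \in H.
  by case/imsetP => a; rewrite inE => /andP[_ aP] ->; rewrite memv_span // mem_enum.
have cH : (#|[set z | z \in H]| <= p ^ m * (m * (L * #|X|)))%N.
  apply: leq_trans (card_span_covering cov P0) _.
  apply: leq_mul; first by rewrite leq_pexp2l // prime_gt0.
  apply: leq_trans (leq_trans _ c4) _; last by rewrite leq_mul2l cP orbT.
  apply/subset_leq_card/subsetP => z zP2; apply/imset2P; exists (z + 0) 0; rewrite ?addr0 //.
  by apply/imset2P; exists z 0; rewrite ?addr0.
have [M [k hk]] := graph_pigeonhole WH.
have Wfib x : (#|[set y | (x, y) \in W]| <= Q)%N.
  apply: leq_trans (hQ (x + b.1)); rewrite -(card_imset _ (addIr b.2)).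
  apply/subset_leq_card/subsetP => y /imsetP[y']; rewrite !inE => /imsetP[a].
  rewrite inE => /andP[aX _] e ->; apply: (subsetP XS).
  have -> : (x + b.1, y' + b.2) = a by rewrite -[a](subrK b) -e.
  by [].
have cWf := leq_card_fibres Wfib.
exists M, (k + b.2 - b.1 *m M).
set c := #|[set x | (x, x *m M + _)%R \in S]|.
have hc : (#|[set x | (x, x *m M + k)%R \in W]| <= c)%N.
  rewrite -(card_imset _ (addIr b.1)).
  apply/subset_leq_card/subsetP => y /imsetP[x]; rewrite !inE => /imsetP[a].
  rewrite inE => /andP[aX _] e ->; apply: (subsetP XS).
  have -> : (x + b.1, (x + b.1) *m M + (k + b.2 - b.1 *m M)) = a; last by [].
  rewrite -[a](subrK b) -e; congr (_, _).
  transitivity (x *m M + k + b.2); last by [].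
  by rewrite mulmxDl; zmod.
have {cWf hk} : (#|X| <= 4 * Q * m * L * p ^ m * c)%N.
  rewrite -(leq_pmul2r X0).
  apply: leq_trans (leq_mul cW cW) _.
  apply: (@leq_trans (4 * (Q * (#|W| * #|fst @: W|)))%N).
    by rewrite mulnACA leq_mul2l /= mulnCA leq_mul2l cWf orbT.
  apply: (@leq_trans (4 * (Q * ((p ^ m * (m * (L * #|X|))) * c)))%N); last by lia.
  rewrite !leq_mul2l /=; apply/orP; right; apply: leq_trans hk _.
  exact: leq_mul.
move=> hX; apply: leq_trans NS _.
apply: leq_trans (leq_mul (leqnn k0) (leq_trans cX (leq_mul (leqnn _) hX))) _.
by rewrite /agree_const -/K -/L -/m leq_eqVlt; apply/orP; left; apply/eqP; lia.
Qed.

End GraphAgreement.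

Lemma leq_card_bigcup (I T : finType) (J : {set I}) (F : I -> {set T}) m :
  (forall i, i \in J -> #|F i| <= m)%N -> (#|\bigcup_(i in J) F i| <= #|J| * m)%N.
Proof.
move=> hF; rewrite -sum_nat_const.
elim/big_rec2: _ => [|i k S iJ IH]; first by rewrite cards0.
by rewrite (leq_trans (leq_card_setU _ _)) // leq_add // hF.
Qed.

(** Nonempty fibres are translates of one another. Affinity is expressed through [a - b + c], which
    makes sense in any abelian group. *)
Lemma affine_fibre (G H : finZmodType) (f : G -> H) t :
    (forall a b c, f (a - b + c) = f a - f b + f c) ->
  (#|f @: [set: G]| * #|[set a | f a == t]| <= #|G|)%N.
Proof.
move=> faff; have [->|] := posnP #|[set a | f a == t]|; first by rewrite muln0.
case/card_gt0P => c; rewrite inE => /eqP fc.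
rewrite -sum_nat_const -[leqRHS]sum1_card.
rewrite (partition_big f (mem (f @: [set: G]))) /=; last first.
  by move=> a _; apply/imsetP; exists a.
apply: leq_sum => t' /imsetP[b _ ->]; rewrite sum1_card.
rewrite -[leqLHS](card_imset _ (addIr (b - c))); apply/subset_leq_card/subsetP => z.
case/imsetP => a; rewrite inE => /eqP fa ->; rewrite unfold_in.
by apply/eqP; rewrite addrA addrAC faff fa fc subrr add0r.
Qed.

(** * Quadruples of points on graphs of affine maps *)

Section PopularStructure.
Variables (p n : nat).
Hypothesis p_prime : prime p.
Local Notation E := 'rV['F_p]_n.
Local Notation Z := (E * E)%type.
Implicit Types (S : {set Z}) (x y r : E) (s : seq ('M['F_p]_n * E)).

Definition aff (a : 'M['F_p]_n * E) x : E := x *m a.1 + a.2.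

Lemma affB a x y z : aff a (x - y + z) = aff a x - aff a y + aff a z.
Proof. by rewrite /aff mulmxDl mulmxBl; zmod. Qed.

Definition on_graphs s : {set Z} := [set z | has (fun a => z.2 == aff a z.1) s].

(** While the energy is large, [affine_agreement] yields a graph with at least [|E| / agree_const]
    points of the set; each removal uses up that many elements of [S]. *)
Lemma greedy_graphs S (k0 Q : nat) :
    (forall x, #|[set y | (x, y) \in S]| <= Q)%N ->
  exists s, (size s * #|E| <= agree_const p k0 Q * #|S|)%N /\
    (k0 * energy (S :\: on_graphs s) < #|E| ^ 3)%N.
Proof.
have [m] := ubnP #|S|; elim: m S => // m IH S; rewrite ltnS => cS hQ.
have [hE|hE] := ltnP (k0 * energy S) (#|E| ^ 3).
  exists [::]; split; first by rewrite mul0n.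
  by rewrite (_ : _ :\: _ = S) //; apply/setP => z; rewrite !inE.
have [M [v hMv]] := affine_agreement p_prime hQ hE.
pose S' := S :\: on_graphs [:: (M, v)].
set C := [set x | _] in hMv.
have cC : (#|C| + #|S'| <= #|S|)%N.
  rewrite -(cardsID (on_graphs [:: (M, v)]) S) leq_add2r.
  rewrite -(card_imset (f := fun x => (x, x *m M + v))); last by move=> x y [].
  apply/subset_leq_card/subsetP => z /imsetP[x]; rewrite inE => xS ->.
  by rewrite !inE xS /= /aff eqxx.
have C0 : (0 < #|C|)%N.
  have : (0 < #|E|)%N by apply/card_gt0P; exists 0.
  by case: #|C| hMv; rewrite // muln0; case: #|E|.
have [||s [hs1 hs2]] := IH S'; first by lia.
  move=> x; apply: leq_trans (hQ x); apply/subset_leq_card/subsetP => y.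
  by rewrite !inE => /andP[].
exists ((M, v) :: s); split.
  rewrite /= mulSn; apply: leq_trans (leq_add hMv hs1) _.
  by rewrite -mulnDr leq_mul2l cC orbT.
rewrite (_ : S :\: _ = S' :\: on_graphs s) //; apply/setP => z.
by rewrite !inE /= orbF negb_or; case: (z \in S); rewrite ?andbF ?andbT // andbC.
Qed.

Section Graphs.
Variable s : seq ('M['F_p]_n * E).
Local Notation k := (size s).
Local Notation J := ('I_k * 'I_k * ('I_k * 'I_k))%type.
Let a_ (i : 'I_k) := nth (0, 0) s i.

(** The value [r1 + r2 - r3 - r4] for points on the four graphs of [j] over [x1], [x2], [x3] and
    [x4 = x1 + x2 - x3]. Moving [x4] by [-x] adds [x] times the last matrix, so one affine map
    serves every [x]. *)
Definition psi (j : J) (u : E * E * E) : E :=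
  aff (a_ j.1.1) u.1.1 + aff (a_ j.1.2) u.1.2 - aff (a_ j.2.1) u.2
    - aff (a_ j.2.2) (u.1.1 + u.1.2 - u.2).

Lemma zmod_affine4 (G : zmodType) (a1 a2 a3 a4 b1 b2 b3 b4 c1 c2 c3 c4 : G) :
  (a1 - b1 + c1) + (a2 - b2 + c2) - (a3 - b3 + c3) - (a4 - b4 + c4) =
  (a1 + a2 - a3 - a4) - (b1 + b2 - b3 - b4) + (c1 + c2 - c3 - c4).
Proof. by zmod. Qed.

Lemma psi_affine j u v w : psi j (u - v + w) = psi j u - psi j v + psi j w.
Proof.
rewrite /psi; transitivity (
  aff (a_ j.1.1) (u.1.1 - v.1.1 + w.1.1) + aff (a_ j.1.2) (u.1.2 - v.1.2 + w.1.2)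
  - aff (a_ j.2.1) (u.2 - v.2 + w.2)
  - aff (a_ j.2.2) ((u.1.1 + u.1.2 - u.2) - (v.1.1 + v.1.2 - v.2) + (w.1.1 + w.1.2 - w.2))).
  congr (_ + _ - _ - aff _ _).
  transitivity (u.1.1 - v.1.1 + w.1.1 + (u.1.2 - v.1.2 + w.1.2) - (u.2 - v.2 + w.2)) => //.
  by zmod.
by rewrite !affB; apply: zmod_affine4.
Qed.

(** Each quadruple is charged to four graphs containing its points; on given graphs its first
    coordinates determine it. *)
Lemma graph_quads S (z : Z) : S \subset on_graphs s ->
  (quads S S S S z <= \sum_j #|[set u | psi j u == (z.2 - z.1 *m (a_ j.2.2).1)%R]|)%N.
Proof.
move=> /subsetP hS; pose on i (w : Z) := w.2 == aff (a_ i) w.1.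
have onP w : w \in S -> exists i, on i w.
  move=> /hS; rewrite inE => /(has_nthP (0, 0))[i hi e].
  by exists (Ordinal hi).
pose T j := [set u : Z * Z * Z | [&& on j.1.1 u.1.1, on j.1.2 u.1.2, on j.2.1 u.2
  & on j.2.2 (u.1.1 + u.1.2 - u.2 - z)]].
apply: (@leq_trans (\sum_(j : J) #|T j|)%N); last first.
  apply: leq_sum => j _.
  rewrite -(card_in_imset (f := fun u : Z * Z * Z => (u.1.1.1, u.1.2.1, u.2.1))).
    apply/subset_leq_card/subsetP => w /imsetP[[[[x1 y1] [x2 y2]] [x3 y3]]].
    rewrite !inE /on /= => /and4P[/eqP-> /eqP-> /eqP-> /eqP e] ->.
    apply/eqP; rewrite /psi /=.
    have {}e : aff (a_ j.1.1) x1 + aff (a_ j.1.2) x2 - aff (a_ j.2.1) x3 - z.2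
      = aff (a_ j.2.2) (x1 + x2 - x3 - z.1) := e.
    have -> : aff (a_ j.2.2) (x1 + x2 - x3) =
       aff (a_ j.2.2) (x1 + x2 - x3 - z.1) + z.1 *m (a_ j.2.2).1.
      by rewrite /aff !mulmxBl; zmod.
    by rewrite -e; move: (aff _ x1) (aff _ x2) (aff _ x3) (_ *m _) => *; zmod.
  move=> [[[x1 y1] [x2 y2]] [x3 y3]] [[[x1' y1'] [x2' y2']] [x3' y3']].
  rewrite !inE /on /= => /and4P[/eqP-> /eqP-> /eqP-> _] /and4P[/eqP-> /eqP-> /eqP-> _].
  by move=> [-> -> ->].
rewrite quadsE (eq_bigr (fun j => \sum_u (u \in T j : nat))%N); last first.
  by move=> j _; rewrite sum_indic.
rewrite exchange_big /=; apply: leq_sum => u _.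
case h1: (u.1.1 \in S) => //; case h2: (u.1.2 \in S) => //; case h3: (u.2 \in S) => //.
case h4: (_ \in S) => //; rewrite !mul1n.
have [j1 e1] := onP _ h1; have [j2 e2] := onP _ h2.
have [j3 e3] := onP _ h3; have [j4 e4] := onP _ h4.
rewrite (bigD1 (j1, j2, (j3, j4))) //= inE /= e1 e2 e3 e4 //.
Qed.

(** By pigeonhole one of the [k^4] choices of graphs has a fibre of [psi] of density at least
    [1 / (e k^4)]; as nonempty fibres have equal size, its image is small. *)
Lemma popular_quad S (z : Z) e : (0 < e)%N -> S \subset on_graphs s ->
    (#|E| ^ 3 <= e * quads S S S S z)%N ->
  exists j, z.2 - z.1 *m (a_ j.2.2).1 \in psi j @: [set: E * E * E] /\
    (#|psi j @: [set: E * E * E]| <= e * k ^ 4)%N.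
Proof.
move=> e0 hS hq; pose t (j : J) := z.2 - z.1 *m (a_ j.2.2).1.
have N0 : (0 < #|E| ^ 3)%N by rewrite expn_gt0; apply/orP; left; apply/card_gt0P; exists 0.
have hsum := leq_trans hq (leq_mul (leqnn e) (graph_quads z hS)).
have [j hj] : exists j, (#|E| ^ 3 <= e * k ^ 4 * #|[set u | psi j u == t j]|)%N.
  apply/existsP; apply: contraT; rewrite negb_exists => /forallP h.
  have cJ : #|{: J}| = (k ^ 4)%N by rewrite !card_prod !card_ord !expnS; lia.
  have : (k ^ 4 * #|E| ^ 3 < k ^ 4 * #|E| ^ 3)%N; last by rewrite ltnn.
  apply: leq_ltn_trans (leq_mul (leqnn _) hsum) _.
  rewrite mulnCA mulnA big_distrr /=.
  (* The strict comparison of sums needs an index; with no graphs the sum vanishes, against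
     [hsum]. *)
  have [j0|k0] := pickP (fun j : J => true); last first.
    exfalso; move: hsum; rewrite big1 ?muln0; first by rewrite leqNgt N0.
    by move=> j _; have := k0 j.
  rewrite -cJ -sum_nat_const [ltnRHS](bigD1 j0) //= (bigD1 j0) //= -addSn leq_add //.
    by rewrite ltnNge cJ h.
  by apply: leq_sum => j _; rewrite cJ ltnW // ltnNge h.
have F0 : (0 < #|[set u | psi j u == t j]|)%N.
  by case: #|_| hj N0; rewrite // muln0; case: (_ ^ 3)%N.
exists j; split.
  case/card_gt0P: F0 => u; rewrite inE => /eqP e1.
  by apply/imsetP; exists u; rewrite -?e1.
rewrite -(leq_pmul2r F0); apply: leq_trans hj.
apply: leq_trans (affine_fibre _ (psi_affine j)) _.
by rewrite !card_prod !expnS expn0 muln1 mulnA.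
Qed.

End Graphs.

(** Chosen so that [(|E|^3 / k0) (Q |E|)^9], one small energy times three trivial bounds, is the
    fourth power of [|E|^3 / (8 e)]. *)
Definition small_energy_const e Q := ((8 * e) ^ 4 * Q ^ 9)%N.
Definition graphs_const e Q := (agree_const p (small_energy_const e Q) Q * Q)%N.

Lemma quads_set_split S S1 S2 (z : Z) : S \subset S1 :|: S2 ->
  (quads S S S S z <= quads S1 S1 S1 S1 z +
    (quads S2 S S S z + quads S S2 S S z + quads S S S2 S z + quads S S S S2 z))%N.
Proof.
move=> /subsetP hS; rewrite !quadsE -!big_split /=; apply: leq_sum => u _.
have {}hS w : w \in S -> (w \in S1) || (w \in S2) by move=> /hS; rewrite inE.
case h1: (u.1.1 \in S) => //; case h2: (u.1.2 \in S) => //; case h3: (u.2 \in S) => //.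
case h4: (_ \in S) => //; rewrite !mul1n !muln1.
move: (hS _ h1) (hS _ h2) (hS _ h3) (hS _ h4).
move: (_ \in S1) (_ \in S1) (_ \in S1) (_ \in S1) => a1 a2 a3 a4.
by move: (_ \in S2) (_ \in S2) (_ \in S2) (_ \in S2); case: a1; case: a2; case: a3; case: a4;
  do 4!case.
Qed.

(** Quadruples meeting the remainder [S2] of the greedy removal make up at most half of a popular
    count, so [popular_quad] applies to the part on the graphs. *)
Lemma popular_structure S e Q :
    (0 < e)%N -> (0 < Q)%N ->
    (forall x, #|[set y | (x, y) \in S]| <= Q)%N ->
  exists s (R : {set E}), [/\ (size s <= graphs_const e Q)%N,
    (#|R| <= 2 * e * size s ^ 8)%N &
    forall x r, (#|E| ^ 3 <= e * quads S S S S (x, r))%N ->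
      exists2 a, a \in s & r - x *m a.1 \in R].
Proof.
move=> e0 Q0 hQ; pose k0 := small_energy_const e Q.
have N0 : (0 < #|E|)%N by apply/card_gt0P; exists 0.
have cS : (#|S| <= Q * #|E|)%N.
  by apply: leq_trans (leq_card_fibres hQ) _; rewrite leq_mul2l max_card orbT.
have [s [hs1 hs2]] := greedy_graphs k0 hQ.
have hs : (size s <= graphs_const e Q)%N.
  by rewrite -(leq_pmul2r N0) -mulnA (leq_trans hs1) // leq_mul2l cS orbT.
pose im j := psi (s := s) j @: [set: E * E * E].
(* Only choices of graphs with small image enter, so the exceptional set is bounded and independent
   of [x] and [r]. *)
pose good := [set j | (#|im j| <= 2 * e * size s ^ 4)%N].
exists s, (\bigcup_(j in good) im j); split=> //.
  apply: (@leq_trans (#|good| * (2 * e * size s ^ 4))%N).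
    by apply: leq_card_bigcup => j; rewrite inE.
  rewrite mulnC -mulnA leq_mul2l (expnD _ 4 4) leq_mul2l; apply/orP; right; apply/orP; right.
  by apply: leq_trans (max_card _) _; rewrite !card_prod !card_ord !expnS; lia.
move=> x r hq; pose S1 := S :&: on_graphs s; pose S2 := S :\: on_graphs s.
have small q : (q ^ 4 <= energy S2 * energy S ^ 3)%N -> (8 * (e * q) <= #|E| ^ 3)%N.
  move=> h; rewrite -(@leq_exp2r _ _ 4) // -(leq_pmul2r (_ : 0 < Q ^ 9)%N) ?expn_gt0 ?Q0 //.
  rewrite mulnA expnMn mulnAC -/(small_energy_const e Q) -/k0.
  apply: leq_trans (leq_mul (leqnn k0) h) _; rewrite mulnA.
  apply: leq_trans (leq_mul (ltnW hs2) (_ : _ <= ((Q * #|E|) ^ 3) ^ 3)%N) _.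
    by rewrite leq_exp2r // (leq_trans (energy_le S)) // leq_exp2r.
  by rewrite -!expnM expnMn mulnCA mulnC -expnD.
(* Four terms with a point in [S2], each at most [|E|^3 / (8 e)], leave half of [|E|^3 / e]. *)
have q1 : (#|E| ^ 3 <= 2 * e * quads S1 S1 S1 S1 (x, r))%N.
  have := @quads_set_split S S1 S2 (x, r); rewrite setID subxx => /(_ isT).
  have {small} small T1 T2 T3 T4 :
     (energy T1 * energy T2 * energy T3 * energy T4 = energy S2 * energy S ^ 3)%N ->
     (8 * (e * quads T1 T2 T3 T4 (x, r)) <= #|E| ^ 3)%N.
    by move=> h; apply: small; rewrite -h; apply: quads_energy.
  have := small S2 S S S; have := small S S2 S S; have := small S S S2 S.
  have := small S S S S2.
  rewrite !expnS expn0 !muln1; set N3 := (#|E| * _)%N in hq *.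
  move=> h4 h3 h2 h1; have {}h4 := h4 ltac:(lia); have {}h3 := h3 ltac:(lia).
  have {}h2 := h2 ltac:(lia); have {}h1 := h1 ltac:(lia).
  move=> h; have {h}:= leq_mul (leqnn e) h; rewrite !mulnDr; move: hq h1 h2 h3 h4.
  by rewrite !expnS expn0 muln1 -/N3; lia.
have [|j [h1 h2]] := popular_quad (_ : 0 < 2 * e)%N (subsetIr _ _) q1; first by rewrite muln_gt0.
exists (nth (0, 0) s j.2.2); first by rewrite mem_nth.
by apply/bigcupP; exists j; rewrite ?inE.
Qed.

End PopularStructure.

(** * Fourier analysis *)

Section Fourier.
Variables (R : rcfType) (p n : nat).
Hypothesis p_prime : prime p.
Local Notation E := 'rV['F_p]_n.
Local Notation C := R[i].
Local Notation N := (#|E|%:R : R).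
Local Open Scope complex_scope.

(** [w] is a root of [1 + X + ... + X^(p-1)], whose value at [1] is [p]. *)
Lemma exists_root_of_unity : exists2 w : C, w ^+ p = 1 & w != 1.
Proof.
pose q : {poly C} := \poly_(i < p) 1.
have sq : size q = p.
  by rewrite size_poly_eq ?oner_eq0.
have /closed_rootP[w wq] : size q != 1%N by rewrite sq neq_ltn prime_gt1 ?orbT.
have qw : \sum_(i < p) w ^+ i = 0.
  move/eqP: wq; rewrite horner_poly => e; rewrite -[RHS]e.
  by apply: eq_bigr => i _; rewrite mul1r.
exists w.
  by apply/eqP; rewrite -subr_eq0 subrX1 qw mulr0.
apply/eqP => w1; move/eqP: qw; rewrite w1 (eq_bigr (fun=> 1)); last first.
  by move=> i _; rewrite expr1n.
by rewrite sumr_const card_ord pnatr_eq0 eqn0Ngt prime_gt0.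
Qed.

Lemma conjc_norm1 (z : C) m : (0 < m)%N -> z ^+ m = 1 -> z * conjc z = 1.
Proof.
move=> m0 zm; have h0 := mulcJ_ge0 z.
have : (z * conjc z) ^+ m = 1.
  by rewrite exprMn -rmorphXn /= zm rmorph1 mulr1.
by move/eqP; rewrite pexpr_eq1 // => /eqP.
Qed.

Lemma exists_additive_character : exists chi : 'F_p -> C,
  [/\ forall a b, chi (a + b) = chi a * chi b, forall a, chi a * conjc (chi a) = 1
    & exists c, chi c != 1].
Proof.
have [w wp w1] := exists_root_of_unity.
(* This expression is the modulus hidden in the type ['F_p]. *)
have wp' : w ^+ (Zp_trunc (pdiv p)).+2 = 1 by rewrite Fp_cast.
exists (fun a => w ^+ a); split.
- move=> a b; by rewrite -exprD -[RHS](expr_mod _ wp').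
- move=> a; apply: (@conjc_norm1 _ p); first exact: prime_gt0.
  by rewrite exprAC wp expr1n.
- exists 1; suff -> : (1 : 'F_p) = 1%N :> nat by rewrite expr1.
  by [].
Qed.

Variable chi : 'F_p -> C.
Hypothesis chiD : forall a b, chi (a + b) = chi a * chi b.
Hypothesis chi_norm : forall a, chi a * conjc (chi a) = 1.
Hypothesis chi_nontrivial : exists c, chi c != 1.

Definition dot (r y : E) : 'F_p := (r *m y^T) 0 0.

Definition ch (r y : E) : C := chi (dot r y).

Lemma dotC r y : dot r y = dot y r.
Proof. by rewrite /dot !mxE; apply: eq_bigr => j _; rewrite !mxE mulrC. Qed.

Lemma dotD r y z : dot r (y + z) = dot r y + dot r z.
Proof. by rewrite /dot linearD mulmxDr mxE. Qed.

Lemma dot0r r : dot r 0 = 0.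
Proof. by rewrite /dot linear0 mulmx0 mxE. Qed.

Lemma dotZl c r y : dot (c *: r) y = c * dot r y.
Proof. by rewrite /dot -scalemxAl mxE. Qed.

Lemma dot_delta i y : dot (delta_mx 0 i) y = y 0 i.
Proof. by rewrite /dot -rowE !mxE. Qed.

Lemma chi0 : chi 0 = 1.
Proof.
have := chi_norm 0; rewrite -{1}(addr0 0) chiD => h.
have h1 : chi 0 * (chi 0 * conjc (chi 0)) = 1 by rewrite mulrA.
by rewrite chi_norm mulr1 in h1.
Qed.

Lemma chiN a : chi (- a) = conjc (chi a).
Proof.
have c0 : chi a != 0.
  by apply: contraTneq (oner_neq0 C) => c0; rewrite -(chi_norm a) c0 mul0r eqxx.
by apply: (mulfI c0); rewrite -chiD subrr chi0 chi_norm.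
Qed.

Lemma chC r y : ch r y = ch y r.
Proof. by rewrite /ch dotC. Qed.

Lemma chD r y z : ch r (y + z) = ch r y * ch r z.
Proof. by rewrite /ch dotD chiD. Qed.

Lemma chN r y : ch r (- y) = conjc (ch r y).
Proof.
by rewrite /ch -chiN; congr chi; apply/eqP; rewrite -addr_eq0 -dotD addNr dot0r.
Qed.

Lemma ch0 r : ch r 0 = 1.
Proof. by rewrite /ch dot0r chi0. Qed.

(** For [y] nonzero, a translation of the summation variable multiplies the sum by a value [chi c]
    other than 1. *)
Lemma sum_ch y : \sum_r ch r y = (if y == 0 then N else 0)%:C.
Proof.
case: eqP => [->|/eqP y0].
  rewrite (eq_bigr (fun=> 1)); last by move=> r _; rewrite ch0.
  by rewrite sumr_const rmorph_nat.
have /rV0Pn[i yi] := y0; have [c hc] := chi_nontrivial.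
pose r0 : E := (c / y 0 i) *: delta_mx 0 i.
have hr0 : ch r0 y = chi c by rewrite /ch dotZl dot_delta divfK.
apply/eqP; rewrite rmorph0 -(mulrI_eq0 _ (lregP (_ : chi c - 1 != 0))) ?subr_eq0 //.
rewrite mulrBl mul1r subr_eq0; apply/eqP.
rewrite [RHS](reindex_inj (addrI r0)) mulr_sumr; apply: eq_bigr => r _ /=.
by rewrite [in RHS]chC chD !(chC y) hr0.
Qed.

Implicit Types (f g w : E -> R).

Definition four f (r : E) : C := \sum_d (f d)%:C * ch r d.

Definition cor f g (d : E) : R := \sum_a f a * g (a - d).

Lemma conjc_realM (a : R) z : conjc (a%:C * z) = a%:C * conjc z.
Proof. by rewrite rmorphM; congr (_ * _); apply: conjc_real. Qed.

Lemma four_cor f g r : four (cor f g) r = four f r * conjc (four g r).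
Proof.
rewrite /four rmorph_sum big_distrl /=.
transitivity (\sum_a \sum_d ((f a)%:C * (g (a - d))%:C) * ch r d).
  rewrite exchange_big; apply: eq_bigr => d _ /=.
  by rewrite rmorph_sum big_distrl; apply: eq_bigr => a _; rewrite rmorphM.
apply: eq_bigr => a _; rewrite big_distrr /=.
rewrite (reindex_inj (h := fun b => a - b)) /=; last by move=> b c /addrI/oppr_inj.
apply: eq_bigr => b _; rewrite subKr chD chN conjc_realM.
by rewrite mulrACA mulrA.
Qed.

Lemma four_inversion f s : \sum_r four f r * ch r (- s) = (N * f s)%:C.
Proof.
transitivity (\sum_d \sum_r (f d)%:C * ch r (d - s)).
  rewrite exchange_big; apply: eq_bigr => r _ /=; rewrite big_distrl /=.
  by apply: eq_bigr => d _; rewrite chD mulrA.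
rewrite (bigD1 s) //= [X in _ + X]big1 ?addr0 => [|d ds].
  by rewrite -mulr_sumr sum_ch subrr eqxx rmorphM mulrC.
by rewrite -mulr_sumr sum_ch subr_eq0 (negbTE ds) mulr0.
Qed.

(** The squared modulus of [four f r], taken in [R] for use in inequalities. *)
Definition sq f (r : E) : R := complex.Re (four f r) ^+ 2 + complex.Im (four f r) ^+ 2.

Lemma sqE f r : (sq f r)%:C = four f r * conjc (four f r).
Proof. by rewrite /sq; case: (four f r) => a b; simpc; rewrite !expr2; congr (_ +i* _); ring. Qed.

Lemma sq_real f r (a : R) : four f r = a%:C -> sq f r = a ^+ 2.
Proof. by rewrite /sq => -> /=; rewrite expr0n addr0. Qed.

Lemma sq_ge0 f r : 0 <= sq f r.
Proof. by rewrite addr_ge0 ?sqr_ge0. Qed.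

Lemma sq_four_cor f r : four (cor f f) r = (sq f r)%:C.
Proof. by rewrite four_cor sqE. Qed.

Lemma parseval f : \sum_r sq f r = N * \sum_y f y ^+ 2.
Proof.
apply: (@complexI R); rewrite rmorph_sum /=.
transitivity (\sum_r four (cor f f) r * ch r (- 0)).
  by apply: eq_bigr => r _; rewrite sq_four_cor oppr0 ch0 mulr1.
rewrite four_inversion; congr (_ * _)%:C; apply: eq_bigr => a _.
by rewrite subr0 expr2.
Qed.

Lemma sum_sq_sq f s :
  \sum_r ((sq f r) ^+ 2)%:C * ch r (- s) = (N * cor (cor f f) (cor f f) s)%:C.
Proof.
rewrite -four_inversion; apply: eq_bigr => r _.
by rewrite four_cor sq_four_cor conjc_real -rmorphM expr2.
Qed.

Lemma Re_sum (I : finType) (F : I -> C) : complex.Re (\sum_i F i) = \sum_i complex.Re (F i).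
Proof. by apply: (big_morph (@complex.Re R)) => // - [a b] [c d]. Qed.

Lemma Re_real_mul (a : R) (z : C) : complex.Re (a%:C * z) = a * complex.Re z.
Proof. by case: z => b c /=; rewrite mul0r subr0. Qed.

Lemma Re_ch_ge r y : -1 <= complex.Re (ch r y).
Proof.
have := chi_norm (dot r y); rewrite -/(ch r y); case: (ch r y) => a b.
simpc => - [] /=; nra.
Qed.

Lemma four0 f : four f 0 = (\sum_y f y)%:C.
Proof.
by rewrite rmorph_sum; apply: eq_bigr => d _; rewrite chC ch0 mulr1.
Qed.

Lemma sq0 f : sq f 0 = (\sum_y f y) ^+ 2.
Proof. exact/sq_real/four0. Qed.

(* With f~(x) = f(-x), [cor f f] is f * f~ and the iterated correlation is
   f * f~ * f * f~. *)
Lemma bogolyubov f (T : R) y :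
    0 <= T -> (forall x, 0 <= f x <= 1) -> 2 * T * N <= (\sum_x f x) ^+ 3 ->
    (forall r, T <= sq f r -> dot r y = 0) ->
  (\sum_x f x) ^+ 4 <= 2 * N * cor (cor f f) (cor f f) y.
Proof.
move=> T0 f01 hT hy; set S := \sum_x f x in hT *.
have S0 : 0 <= S by apply: sumr_ge0 => x _; case/andP: (f01 x).
have e1 : N * cor (cor f f) (cor f f) y = \sum_r sq f r ^+ 2 * complex.Re (ch r (- y)).
  transitivity (complex.Re (N * cor (cor f f) (cor f f) y)%:C) => //.
  rewrite -sum_sq_sq Re_sum; apply: eq_bigr => r _; exact: Re_real_mul.
have e2 : \sum_r sq f r <= N * S.
  rewrite parseval ler_wpM2l ?ler0n //; apply: ler_sum => x _.
  by have := f01 x; rewrite expr2; nra.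
(* A large frequency has character value 1 at [y], so its term is nonnegative; for the others
   [sq^2 <= T sq] and the real part is at least -1. *)
have h r : - (T * sq f r) <= sq f r ^+ 2 * complex.Re (ch r (- y)).
  have s0 := sq_ge0 f r; have [/hy e|lt] := lerP T (sq f r).
    have -> : ch r (- y) = 1 by rewrite chN /ch e chi0 rmorph1.
    by rewrite /= mulr1; nra.
  have := Re_ch_ge r (- y); have : sq f r * sq f r <= T * sq f r by nra.
  by rewrite expr2; nra.
(* Frequency 0 contributes [S^4] and the others lose at most [T N S] by Parseval, which is at most
   half of [S^4] as [2 T N <= S^3]. *)
have e3 : S ^+ 4 - T * (N * S) <= N * cor (cor f f) (cor f f) y.
  rewrite e1 (bigD1 0) //= chC ch0 /= mulr1 sq0 -/S -exprM lerD2l.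
  apply: le_trans (_ : \sum_(r | r != 0) - (T * sq f r) <= _); last exact: ler_sum.
  rewrite sumrN lerN2 -mulr_sumr ler_wpM2l //; apply: le_trans e2.
  by rewrite [leRHS](bigD1 0) //= lerDr sq_ge0.
have : 2 * T * N * S <= S ^+ 3 * S by rewrite ler_wpM2r.
by rewrite -exprSr; nra.
Qed.

Lemma card_large_spectrum f (T : R) :
    (forall x, 0 <= f x <= 1) ->
  #|[set r | T <= sq f r]|%:R * T <= N ^+ 2.
Proof.
move=> f01; rewrite mulr_natl -sumr_const.
apply: le_trans (_ : \sum_r sq f r <= _).
  rewrite [leRHS](bigID (mem [set r | T <= sq f r])) /= -[leLHS]addr0 lerD //.
    by apply: ler_sum => r; rewrite inE.
  by apply: sumr_ge0 => r _; apply: sq_ge0.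
rewrite parseval expr2 ler_wpM2l ?ler0n //.
apply: le_trans (_ : \sum_(y : E) 1 <= _); last by rewrite sumr_const.
by apply: ler_sum => y _; have := f01 y; rewrite expr2; nra.
Qed.

End Fourier.

(** * Autocorrelations of fibres and their Fourier weights *)

Section Weights.
Variables (R : rcfType) (p n : nat).
Local Notation E := 'rV['F_p]_n.
Local Notation Z := (E * E)%type.
Local Notation C := R[i].
Local Notation N := (#|E|%:R : R).
Local Open Scope complex_scope.
Variable chi : 'F_p -> C.
Hypothesis chiD : forall a b, chi (a + b) = chi a * chi b.
Hypothesis chi_norm : forall a, chi a * conjc (chi a) = 1.
Hypothesis chi_nontrivial : exists c, chi c != 1.
Variable A : {set Z}.
Local Notation ch := (ch chi).
Local Notation four := (four chi).
Local Notation sq := (sq chi).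

Lemma N_gt0 : 0 < N.
Proof. by rewrite ltr0n; apply/card_gt0P; exists 0. Qed.
Let N0 := N_gt0.

Lemma cor_cor_quad (f1 f2 f3 f4 : E -> R) s :
  cor (cor f1 f3) (cor f4 f2) s =
  \sum_(r : E * E * E) f1 r.1.1 * f2 r.1.2 * f3 r.2 * f4 (r.1.1 + r.1.2 - r.2 - s).
Proof.
transitivity (\sum_r1 \sum_r2 \sum_r3 f1 r1 * f2 r2 * f3 r3 * f4 (r1 + r2 - r3 - s));
  last first.
  rewrite pair_bigA /= (pair_bigA _ (fun (u : E * E) r3 =>
     f1 u.1 * f2 u.2 * f3 r3 * f4 (u.1 + u.2 - r3 - s))) //.
rewrite /cor.
transitivity (\sum_r1 \sum_d \sum_b f1 r1 * f3 (r1 - d) * (f4 b * f2 (b - (d - s)))).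
  rewrite exchange_big; apply: eq_bigr => d _ /=; rewrite big_distrl /=.
  by apply: eq_bigr => r1 _; rewrite big_distrr.
apply: eq_bigr => r1 _; rewrite [RHS]exchange_big /=.
rewrite (reindex_inj (h := fun b => r1 - b)) /=; last by move=> b c /addrI/oppr_inj.
apply: eq_bigr => r3 _.
rewrite (reindex_inj (h := fun b => b + (r1 - r3 - s))) /=; last exact: addIr.
apply: eq_bigr => r2 _; rewrite subKr addrK.
rewrite (_ : r2 + (r1 - r3 - s) = r1 + r2 - r3 - s); last by zmod.
ring.
Qed.

Definition ind (S : {set E}) y : R := (y \in S)%:R.

(** [f_x] scaled to take values in [[0, 1]]. Likewise [weight] is the squared Fourier coefficient
    for the averaging measure, which makes its sum over [r] the density. *)
Definition phi x y : R := cor (ind (fiber_fst A x)) (ind (fiber_fst A x)) y / N.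

Definition weight (z : Z) : R := sq (ind (fiber_fst A z.1)) z.2 / N ^+ 2.

Definition density x : R := #|fiber_fst A x|%:R / N.

Lemma sum_ind S : \sum_y ind S y = #|S|%:R.
Proof.
rewrite -sum1_card natr_sum [RHS]big_mkcond; apply: eq_bigr => y _ /=.
by rewrite /ind; case: (y \in S).
Qed.

Lemma ind01 S y : 0 <= ind S y <= 1.
Proof. by rewrite /ind; case: (y \in S); rewrite lexx ler01. Qed.

Lemma density01 x : 0 <= density x <= 1.
Proof.
by rewrite divr_ge0 ?ler0n //= ler_pdivrMr // mul1r ler_nat max_card.
Qed.

Lemma phi01 x y : 0 <= phi x y <= 1.
Proof.
rewrite /phi divr_ge0 ?ler0n ?sumr_ge0 //=; last first.
  by move=> a _; rewrite mulr_ge0 //; case/andP: (ind01 (fiber_fst A x) _).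
rewrite ler_pdivrMr // mul1r; apply: le_trans (_ : \sum_(a : E) 1 <= _).
  apply: ler_sum => a _.
  have /andP[h1 h2] := ind01 (fiber_fst A x) a.
  have /andP[h3 h4] := ind01 (fiber_fst A x) (a - y).
  nra.
by rewrite sumr_const.
Qed.

Lemma weight_ge0 z : 0 <= weight z.
Proof. by rewrite divr_ge0 ?sq_ge0 ?exprn_ge0 ?ler0n. Qed.

Lemma weight4_ge0 z1 z2 z3 z4 : 0 <= weight z1 * weight z2 * weight z3 * weight z4.
Proof. by do 3!(apply: mulr_ge0; last exact: weight_ge0); apply: weight_ge0. Qed.

Lemma weight0 x : weight (x, 0) = density x ^+ 2.
Proof. by rewrite /weight /= sq0 // sum_ind /density expr_div_n. Qed.

Lemma sum_weight x : \sum_r weight (x, r) = density x.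
Proof.
rewrite /weight /= -mulr_suml parseval // /density -sum_ind.
rewrite (eq_bigr (ind (fiber_fst A x))); last first.
  by move=> y _; rewrite /ind; case: (y \in _); rewrite ?expr1n ?expr0n.
by field; rewrite gt_eqF.
Qed.

Lemma weight_le1 z : weight z <= 1.
Proof.
case: z => x r; apply: le_trans (_ : density x <= 1); last by case/andP: (density01 x).
rewrite -sum_weight (bigD1 r) //= lerDl sumr_ge0 // => s _; exact: weight_ge0.
Qed.

(** Fourier inversion: up to scaling, [weight] is the transform of the autocorrelation [phi]. *)
Lemma four_weight x y : four (fun r => weight (x, r)) (- y) = (phi x y)%:C.
Proof.
have /= h := four_inversion chiD chi_norm chi_nontrivial
  (cor (ind (fiber_fst A x)) (ind (fiber_fst A x))) y.
apply: (@mulfI _ (N ^+ 2)%:C); first by rewrite rmorphXn expf_neq0 // rmorph_nat pnatr_eq0 -lt0n -(ltr0n R).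
rewrite -rmorphM /= [in RHS]/phi (_ : N ^+ 2 * _ = N * cor (ind (fiber_fst A x)) (ind (fiber_fst A x)) y).
  rewrite -h [in LHS]/four mulr_sumr; apply: eq_bigr => r _.
  rewrite sq_four_cor // (chC chi _ r) mulrA -rmorphM; congr (_%:C * _).
  by rewrite /weight /=; field; rewrite gt_eqF.
by field; rewrite gt_eqF.
Qed.

Definition quadw (z : Z) : R :=
  \sum_(u : Z * Z * Z) weight u.1.1 * weight u.1.2 * weight u.2 *
     weight (u.1.1 + u.1.2 - u.2 - z).

Lemma quadwE x s : quadw (x, s) = \sum_(v : E * E * E) \sum_(r : E * E * E)
  weight (v.1.1, r.1.1) * weight (v.1.2, r.1.2) * weight (v.2, r.2) *
  weight (v.1.1 + v.1.2 - v.2 - x, r.1.1 + r.1.2 - r.2 - s).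
Proof.
rewrite pair_bigA /= /quadw.
rewrite (reindex (fun w : E * E * E * (E * E * E) =>
  ((w.1.1.1, w.2.1.1), (w.1.1.2, w.2.1.2), (w.1.2, w.2.2)))) //=.
exists (fun u : Z * Z * Z => ((u.1.1.1, u.1.2.1, u.2.1), (u.1.1.2, u.1.2.2, u.2.2))).
  by move=> [[[? ?] ?] [[? ?] ?]].
by move=> [[[? ?] [? ?]] [? ?]].
Qed.

(** [h_x], averaged over the [N^3] triples that determine a quadruple. *)
Definition hfun x y : R := (\sum_(v : E * E * E)
  phi v.1.1 y * phi v.1.2 y * phi v.2 y * phi (v.1.1 + v.1.2 - v.2 - x) y) / N ^+ 3.

(** For fixed [v], the product of four values of [phi] is the transform of an iterated correlation
    of weights, and inversion gives back that correlation. *)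
Lemma four_hfun x s : four (hfun x) s = (quadw (x, s) / N ^+ 2)%:C.
Proof.
have hv (v : E * E * E) : \sum_y (phi v.1.1 y * phi v.1.2 y * phi v.2 y *
   phi (v.1.1 + v.1.2 - v.2 - x) y)%:C * ch s y = (N * \sum_(r : E * E * E)
  weight (v.1.1, r.1.1) * weight (v.1.2, r.1.2) * weight (v.2, r.2) *
  weight (v.1.1 + v.1.2 - v.2 - x, r.1.1 + r.1.2 - r.2 - s))%:C.
  rewrite -(cor_cor_quad (fun r => weight (v.1.1, r)) (fun r => weight (v.1.2, r))
    (fun r => weight (v.2, r)) (fun r => weight (v.1.1 + v.1.2 - v.2 - x, r))).
  rewrite -(four_inversion chiD chi_norm chi_nontrivial).
  rewrite [RHS](reindex_inj oppr_inj); apply: eq_bigr => y _ /=.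
  rewrite !four_cor // !four_weight !conjc_real.
  rewrite chN // (chC chi _ s) chN // conjcK.
  congr (_ * _); rewrite conjc_realM conjc_real -!rmorphM; congr (_%:C); ring.
rewrite quadwE /four.
transitivity (\sum_y (N ^- 3)%:C * \sum_(v : E * E * E) (phi v.1.1 y * phi v.1.2 y * phi v.2 y *
   phi (v.1.1 + v.1.2 - v.2 - x) y)%:C * ch s y).
  apply: eq_bigr => y _; rewrite -mulr_suml -rmorph_sum /= mulrA -rmorphM /=.
  by congr (_%:C * _); rewrite mulrC.
rewrite -mulr_sumr exchange_big /= (eq_bigr _ (fun v _ => hv v)) -rmorph_sum -rmorphM /=.
congr (_%:C); rewrite -mulr_sumr.
by field; rewrite gt_eqF.
Qed.

Lemma hfun01 x y : 0 <= hfun x y <= 1.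
Proof.
have h (v : E * E * E) : 0 <= phi v.1.1 y * phi v.1.2 y * phi v.2 y *
   phi (v.1.1 + v.1.2 - v.2 - x) y <= 1.
  have /andP[a1 b1] := phi01 v.1.1 y; have /andP[a2 b2] := phi01 v.1.2 y.
  have /andP[a3 b3] := phi01 v.2 y; have /andP[a4 b4] := phi01 (v.1.1 + v.1.2 - v.2 - x) y.
  have c2 := mulr_ge0 a1 a2; have c3 := mulr_ge0 c2 a3.
  by rewrite (mulr_ge0 c3 a4) (mulr_ile1 c3 a4 (mulr_ile1 c2 a3 (mulr_ile1 a1 a2 b1 b2) b3) b4).
rewrite /hfun divr_ge0 ?exprn_ge0 ?ler0n ?sumr_ge0 //=; last by move=> v _; case/andP: (h v).
rewrite ler_pdivrMr ?exprn_gt0 // mul1r.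
apply: le_trans (_ : \sum_(v : E * E * E) 1 <= _).
  by apply: ler_sum => v _; case/andP: (h v).
by rewrite sumr_const !card_prod !natrM !exprS expr0 mulr1 mulrA.
Qed.

Lemma sum_gt0_exists (I : finType) (F : I -> R) :
  0 < \sum_i F i -> exists i, 0 < F i.
Proof.
move=> h; apply/existsP; apply: contraLR h; rewrite negb_exists -leNgt => /forallP h.
by apply: sumr_le0 => i _; rewrite leNgt h.
Qed.

Lemma phi_gt0 x y : 0 < phi x y -> y \in setSub (fiber_fst A x) (fiber_fst A x).
Proof.
rewrite /phi pmulr_lgt0 ?invr_gt0 // => /sum_gt0_exists[a].
rewrite /ind; case h1: (a \in _); last by rewrite mul0r ltxx.
case h2: (a - y \in _); last by rewrite mulr0 ltxx.
by move=> _; apply/imset2P; exists a (a - y) => //; rewrite subKr.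
Qed.

Lemma pmulr4_gt0 (a b c d : R) : 0 <= a -> 0 <= b -> 0 <= c -> 0 <= d ->
  0 < a * b * c * d -> [/\ 0 < a, 0 < b, 0 < c & 0 < d].
Proof.
rewrite !le0r => /predU1P[->|a0]; first by rewrite !mul0r ltxx.
move=> /predU1P[->|b0]; first by rewrite mulr0 !mul0r ltxx.
move=> /predU1P[->|c0]; first by rewrite mulr0 !mul0r ltxx.
by move=> /predU1P[->|d0]; first by rewrite mulr0 ltxx.
Qed.

(** A positive average has a positive term: a quadruple [x1 + x2 - x3 - x4 = x] with [y] in the
    difference set of each fibre. *)
Lemma hfun_gt0 x y : 0 < hfun x y -> (x, y) \in step2 A.
Proof.
rewrite /hfun pmulr_lgt0 ?invr_gt0 ?exprn_gt0 // => /sum_gt0_exists[v].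
have p0 x' : 0 <= phi x' y by case/andP: (phi01 x' y).
case/pmulr4_gt0 => // /phi_gt0 h1 /phi_gt0 h2 /phi_gt0 h3 /phi_gt0 h4.
apply/bigcupP; exists y => //; rewrite !inE /= eqxx andbT.
rewrite -[x in x \in _](_ : v.1.1 + v.1.2 - v.2 - (v.1.1 + v.1.2 - v.2 - x) = x); last by zmod.
have st x' : y \in setSub (fiber_fst A x') (fiber_fst A x') -> x' \in fiber_snd (step1 A) y.
  by move=> h; rewrite inE; apply/bigcupP; exists x' => //; rewrite !inE eqxx.
by apply: set2A2SP; apply: st.
Qed.

Lemma cor_hfun_gt0 x y :
  0 < cor (cor (hfun x) (hfun x)) (cor (hfun x) (hfun x)) y -> (x, y) \in step3 A.
Proof.
rewrite cor_cor_quad => /sum_gt0_exists[v].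
have p0 y' : 0 <= hfun x y' by case/andP: (hfun01 x y').
case/pmulr4_gt0 => // /hfun_gt0 h1 /hfun_gt0 h2 /hfun_gt0 h3 /hfun_gt0 h4.
apply/bigcupP; exists x => //; rewrite in_setX set11 /=.
rewrite -[y in y \in _](_ : v.1.1 + v.1.2 - v.2 - (v.1.1 + v.1.2 - v.2 - y) = y); last by zmod.
by apply: set2A2SP; rewrite inE.
Qed.

Local Notation dens2 := (fun x => density x ^+ 2).

(** Of the inner sum only the term with all frequencies 0 is kept. *)
Lemma quadw_x0 x : cor (cor dens2 dens2) (cor dens2 dens2) x <= quadw (x, 0).
Proof.
rewrite cor_cor_quad quadwE; apply: ler_sum => v _.
rewrite (bigD1 (0, 0, 0)) //= !subr0 addr0 !weight0 lerDl sumr_ge0 // => r _.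
exact: weight4_ge0.
Qed.

(** The mean of [hfun x] is [quadw (x, 0) / N^3], at least [d], and its large frequencies are the
    [s] with [quadw (x, s)] large; Bogolyubov's argument makes the iterated correlation positive at
    [y]. *)
Lemma step3_of_orthogonal (d e : R) x y :
    0 < d -> 0 <= e -> 2 * e ^+ 2 <= d ^+ 3 ->
    d * N ^+ 3 <= cor (cor dens2 dens2) (cor dens2 dens2) x ->
    (forall s, e * N ^+ 3 <= quadw (x, s) -> dot s y = 0) ->
  (x, y) \in step3 A.
Proof.
move=> d0 e0 de hd hs; apply: cor_hfun_gt0.
have S : d * N <= \sum_y' hfun x y'.
  have := four_hfun x 0; rewrite four0 // => /complexI ->.
  rewrite ler_pdivlMr ?exprn_gt0 // -mulrA -exprS; apply: le_trans hd _.
  exact: quadw_x0.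
have dN : 0 < d * N by rewrite mulr_gt0.
have S0 : 0 < \sum_y' hfun x y' by apply: lt_le_trans S.
suff h : (\sum_y' hfun x y') ^+ 4 <=
    2 * N * cor (cor (hfun x) (hfun x)) (cor (hfun x) (hfun x)) y.
  have : 0 < 2 * N * cor (cor (hfun x) (hfun x)) (cor (hfun x) (hfun x)) y.
    by apply: lt_le_trans h; rewrite exprn_gt0.
  by rewrite pmulr_rgt0 // mulr_gt0.
have eN : 0 <= e * N by rewrite mulr_ge0 // ltW.
(* This threshold corresponds to [quadw (x, s) >= e N^3], and [2 T N <= (d N)^3] is the assumption
   [2 e^2 <= d^3]. *)
apply: (bogolyubov (T := (e * N) ^+ 2) chiD chi_norm chi_nontrivial) => [|||s].
- exact: exprn_ge0.
- exact: hfun01.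
- apply: le_trans (_ : (d * N) ^+ 3 <= _); last by rewrite lerXn2r ?nnegrE // ltW.
  rewrite !exprMn mulrA -mulrA -exprSr ler_wpM2r // exprn_ge0 // ltW //.
rewrite (sq_real (four_hfun x s)) => h; apply: hs.
have q0 : 0 <= quadw (x, s) by apply: sumr_ge0 => u _; apply: weight4_ge0.
have : e * N <= quadw (x, s) / N ^+ 2.
  have q1 : 0 <= quadw (x, s) / N ^+ 2 by rewrite divr_ge0 // exprn_ge0 // ltW.
  by move: h; rewrite ler_pXn2r ?nnegrE.
by rewrite ler_pdivlMr ?exprn_gt0 // -mulrA -exprS.
Qed.

End Weights.

(** * The bilinear argument *)

(** [U] is the kernel of the matrix whose columns are the elements of [S], so its codimension is a
    rank. *)
Lemma annihilator (p n : nat) (S : {set 'rV['F_p]_n}) :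
  exists2 U : {vspace 'rV['F_p]_n}, (codim U <= #|S|)%N &
    forall x r, x \in U -> r \in S -> dot r x = 0.
Proof.
pose M := \matrix_(j < n, i < #|S|) (enum_val i : 'rV['F_p]_n) 0 j.
exists (lker (linfun (mulmxr M))).
  rewrite /codim -(limg_ker_dim (linfun (mulmxr M)) fullv) capfv addKn.
  by apply: leq_trans (dimvS (subvf _)) _; rewrite dimvf /dim /= mul1n.
move=> x r; rewrite memv_ker lfunE /= => /eqP xM rS.
have := congr1 (fun m : 'rV__ => m 0 (enum_rank_in rS r)) xM; rewrite !mxE => e.
rewrite dotC /dot mxE -[RHS]e; apply: eq_bigr => j _.
by rewrite !mxE enum_rankK_in.
Qed.

Section RealSums.
Variables (R : realFieldType) (Z : finZmodType).
Variable g : Z -> R.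
Hypothesis g01 : forall z, 0 <= g z <= 1.

Lemma sum_addr z : \sum_a g (z + a) = \sum_a g a.
Proof. by rewrite [RHS](reindex_inj (addrI z)). Qed.

Lemma sum_subr z : \sum_a g (z - a) = \sum_a g a.
Proof. by rewrite [RHS](reindex_inj (h := fun a => z - a)) // => a b /addrI/oppr_inj. Qed.

Lemma sum3E (f1 f2 f3 : Z -> R) : \sum_z1 \sum_z2 \sum_z3 f1 z1 * f2 z2 * f3 z3 =
  (\sum_z f1 z) * (\sum_z f2 z) * (\sum_z f3 z).
Proof.
rewrite -mulrA mulr_suml; apply: eq_bigr => z1 _; rewrite mulrCA mulr_suml.
by apply: eq_bigr => z2 _; rewrite -mulr_sumr mulrA (mulrC (f2 z2)).
Qed.

(* A quadruple with an element of weight less than eta contributes at most eta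
   times the product of the other three weights. *)
Lemma quads_of_weight (eta : R) z : 0 <= eta ->
  \sum_(u : Z * Z * Z) g u.1.1 * g u.1.2 * g u.2 * g (u.1.1 + u.1.2 - u.2 - z) <=
  (quads [set z | eta <= g z] [set z | eta <= g z] [set z | eta <= g z]
     [set z | eta <= g z] z)%:R + 4 * eta * (\sum_z g z) ^+ 3.
Proof.
move=> eta0; set S := [set z | eta <= g z]; pose G := \sum_z g z.
pose z4 (u : Z * Z * Z) := u.1.1 + u.1.2 - u.2 - z.
have pt u : g u.1.1 * g u.1.2 * g u.2 * g (z4 u) <=
   ((u.1.1 \in S) * (u.1.2 \in S) * (u.2 \in S) * (z4 u \in S))%:R +
   eta * (g u.1.2 * g u.2 * g (z4 u) + g u.1.1 * g u.2 * g (z4 u)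
        + g u.1.1 * g u.1.2 * g (z4 u) + g u.1.1 * g u.1.2 * g u.2).
  move: (g01 u.1.1) (g01 u.1.2) (g01 u.2) (g01 (z4 u)); rewrite !inE.
  move: (g u.1.1) (g u.1.2) (g u.2) (g (z4 u)) => a b c d.
  move=> /andP[a0 a1] /andP[b0 b1] /andP[c0 c1] /andP[d0 d1].
  have abc : 0 <= a * b * c by rewrite !mulr_ge0.
  have abd : 0 <= a * b * d by rewrite !mulr_ge0.
  have acd : 0 <= a * c * d by rewrite !mulr_ge0.
  have bcd : 0 <= b * c * d by rewrite !mulr_ge0.
  have pos : 0 <= eta * (b * c * d + a * c * d + a * b * d + a * b * c).
    by rewrite mulr_ge0 ?addr_ge0.
  have [ha|ha] := leP eta a; last by rewrite !mul0n add0r; nra.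
  have [hb|hb] := leP eta b; last by rewrite muln0 !mul0n add0r; nra.
  have [hc|hc] := leP eta c; last by rewrite muln0 mul0n add0r; nra.
  have [hd|hd] := leP eta d; last by rewrite muln0 add0r; nra.
  have ab := mulr_ge0 a0 b0.
  have h := mulr_ile1 abc d0 (mulr_ile1 ab c0 (mulr_ile1 a0 b0 a1 b1) c1) d1.
  by rewrite !muln1 -[leLHS]addr0; apply: lerD.
apply: le_trans (ler_sum _ (fun u _ => pt u)) _.
rewrite big_split /= quadsE natr_sum lerD2l -mulr_sumr !big_split /=.
have nest (F : Z -> Z -> Z -> R) : \sum_(u : Z * Z * Z) F u.1.1 u.1.2 u.2 =
    \sum_z1 \sum_z2 \sum_z3 F z1 z2 z3.
  by rewrite pair_bigA /= (pair_bigA _ (fun (u : Z * Z) z3 => F u.1 u.2 z3)).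
(* Where the fourth point occurs, a translation or reflection of the missing variable makes the
   three factors independent. *)
have s1 : \sum_u g u.1.2 * g u.2 * g (z4 u) = G ^+ 3.
  rewrite (nest (fun z1 z2 z3 => g z2 * g z3 * g (z1 + z2 - z3 - z))) exchange_big /=.
  rewrite !exprS expr0 mulr1 mulrA -sum3E; apply: eq_bigr => z2 _.
  rewrite exchange_big; apply: eq_bigr => z3 _ /=; rewrite -!mulr_sumr; congr (_ * _).
  rewrite -[RHS](sum_addr (z2 - z3 - z)); apply: eq_bigr => z1 _.
  by congr g; zmod.
have s2 : \sum_u g u.1.1 * g u.2 * g (z4 u) = G ^+ 3.
  rewrite (nest (fun z1 z2 z3 => g z1 * g z3 * g (z1 + z2 - z3 - z))).
  rewrite !exprS expr0 mulr1 mulrA -sum3E; apply: eq_bigr => z1 _.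
  rewrite exchange_big; apply: eq_bigr => z3 _ /=; rewrite -!mulr_sumr; congr (_ * _).
  rewrite -[RHS](sum_addr (z1 - z3 - z)); apply: eq_bigr => z2 _.
  by congr g; zmod.
have s3 : \sum_u g u.1.1 * g u.1.2 * g (z4 u) = G ^+ 3.
  rewrite (nest (fun z1 z2 z3 => g z1 * g z2 * g (z1 + z2 - z3 - z))).
  rewrite !exprS expr0 mulr1 mulrA -sum3E; apply: eq_bigr => z1 _; apply: eq_bigr => z2 _.
  rewrite -!mulr_sumr; congr (_ * _).
  rewrite -[RHS](sum_subr (z1 + z2 - z)); apply: eq_bigr => z3 _.
  by congr g; zmod.
have s4 : \sum_(u : Z * Z * Z) g u.1.1 * g u.1.2 * g u.2 = G ^+ 3.
  by rewrite (nest (fun z1 z2 z3 => g z1 * g z2 * g z3)) sum3E !exprS expr0 mulr1 mulrA.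
rewrite s1 s2 s3 s4 -/G; lra.
Qed.

End RealSums.

Section Bilinear.
Variables (p n : nat) (s : seq ('M['F_p]_n * 'rV['F_p]_n)).

Definition graph_form (x y : 'rV['F_p]_n) : 'rV['F_p]_(size s) :=
  \row_i dot (x *m (nth (0, 0) s i).1) y.

Lemma graph_form_bilinear : bilinear_for *:%R *:%R graph_form.
Proof.
split=> u a v w; apply/rowP => i; rewrite !mxE.
  by rewrite mulmxDl -scalemxAl !(dotC _ u) dotD !(dotC u) dotZl.
by rewrite dotD !(dotC _ (_ *: v)) dotZl (dotC v).
Qed.

HB.instance Definition _ := bilinear_isBilinear.Build 'F_p 'rV['F_p]_n
  'rV['F_p]_n 'rV['F_p]_(size s) *:%R *:%R graph_form graph_form_bilinear.

Lemma graph_form_biaffine : biaffine graph_form.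
Proof.
have [hl hr] := graph_form_bilinear.
have l0 u : graph_form 0 u = 0 by have := hl u (-1) 0 0; rewrite scaler0 addr0 /= scaleN1r addNr.
have r0 u : graph_form u 0 = 0 by have := hr u (-1) 0 0; rewrite scaler0 addr0 /= scaleN1r addNr.
split=> [x|y] a u v; rewrite ?l0 ?r0 ?subr0; [exact: hr | exact: hl].
Qed.

Lemma graph_form_eq0 x y : graph_form x y = 0 ->
  forall a, a \in s -> dot (x *m a.1) y = 0.
Proof.
move=> h a /(nthP (0, 0))[i hi <-].
by have := congr1 (fun m : 'rV__ => m 0 (Ordinal hi)) h; rewrite !mxE.
Qed.

End Bilinear.

(** Of a weighted count [N^3 / (4 t^12)], weights below [1 / (32 t^12)] carry at most
    [N^3 / (8 t^12)], so a count [N^3 / (8 t^12)] of quadruples of large weight remains. *)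
Definition pop_const t := (8 * t ^ 12)%N.
Definition fibre_const t := (32 * t ^ 12)%N.
Definition form_const p t := graphs_const p (pop_const t) (fibre_const t).

Section DenseSets.
Variables (R : rcfType) (p n : nat).
Hypothesis p_prime : prime p.
Local Notation E := 'rV['F_p]_n.
Local Notation Z := (E * E)%type.
Local Notation N := (#|E|%:R : R).

(** Bogolyubov's argument for the squared densities gives [U], on which [h_x] has large mean; [V] is
    orthogonal to the exceptional set of [popular_structure], applied to the pairs of large
    weight. *)
Lemma bilinear_bogolyubov (A : {set Z}) t : (0 < t)%N -> (#|E| ^ 2 <= t * #|A|)%N ->
  exists (U V : {vspace E}) (s : seq ('M['F_p]_n * E)),
  [/\ (codim U <= 2 * t ^ 6)%N, (size s <= form_const p t)%N,
    (codim V <= 2 * pop_const t * size s ^ 8)%N &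
    forall x y, x \in U -> y \in V -> (forall a, a \in s -> dot (x *m a.1) y = 0) ->
      (x, y) \in step3 A].
Proof.
move=> t0 hA; have N0 := N_gt0 R p n.
have [chi [chiD chi1 chin]] := exists_additive_character R p_prime.
have T0 : 0 < t%:R :> R by rewrite ltr0n.
set T : R := t%:R in T0.
pose dens2 x := density R A x ^+ 2.
have d01 x : 0 <= dens2 x <= 1.
  have /andP[h0 h1] := density01 R A x.
  by rewrite exprn_ge0 //= exprn_ile1.
have S0 : N <= T ^+ 2 * \sum_x dens2 x.
  have h : N ^+ 2 <= T * \sum_x #|fiber_fst A x|%:R.
    by rewrite -natr_sum sum_card_fibre -natrX -natrM ler_nat.
  have {}h : N <= T * \sum_x density R A x.
    by rewrite -mulr_suml mulrA ler_pdivlMr // -expr2.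
  (* A pointwise form of Cauchy-Schwarz: [(T density - 1)^2 >= 0]. *)
  have : \sum_(x : E) (2 * T * density R A x - 1) <= \sum_x T ^+ 2 * dens2 x.
    apply: ler_sum => x _; rewrite /dens2.
    by have := sqr_ge0 (T * density R A x - 1); rewrite sqrrB exprMn; lra.
  rewrite -mulr_sumr sumrB -mulr_sumr sumr_const; lra.
(* Makes [2 TU N] equal to [(N / T^2)^3], a lower bound for the cube of the sum of [dens2]. *)
pose TU : R := N ^+ 2 / (2 * T ^+ 6).
have TU0 : 0 <= TU by rewrite divr_ge0 ?exprn_ge0 ?mulr_ge0 ?exprn_ge0 // ltW.
pose large := [set r | TU <= sq chi dens2 r].
have clarge : (#|large| <= 2 * t ^ 6)%N.
  have := card_large_spectrum chiD chi1 chin TU d01.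
  rewrite -/large /TU mulrA ler_pdivrMr ?mulr_gt0 ?exprn_gt0 // mulrC ler_pM2l ?exprn_gt0 //.
  by rewrite -natrX -natrM ler_nat.
have [U cU hU] := annihilator large.
(* [d N^3 = (N / T^2)^4 / (2 N)] is what Bogolyubov's argument yields on [U]; [e] solves
   [2 e^2 = d^3]. *)
pose e : R := (4 * T ^+ 12)^-1; pose d : R := (2 * T ^+ 8)^-1.
pose Q := fibre_const t.
have Q0 : (0 < Q)%N by rewrite muln_gt0 expn_gt0 t0.
have e0 : (0 < pop_const t)%N by rewrite muln_gt0 expn_gt0 t0.
have QE : Q%:R = 32 * T ^+ 12 :> R by rewrite natrM natrX.
pose Gam := [set z | Q%:R^-1 <= weight chi A z].
have fib x : (#|[set y | (x, y) \in Gam]| <= Q)%N.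
  have h : #|[set y | (x, y) \in Gam]|%:R * Q%:R^-1 <= 1 :> R.
    apply: le_trans (_ : density R A x <= 1); last by case/andP: (density01 R A x).
    rewrite -(sum_weight chiD chi1 chin) mulr_natl -sumr_const.
    rewrite [leRHS](bigID (mem [set y | (x, y) \in Gam])) /= -[leLHS]addr0 lerD //.
      by apply: ler_sum => r; rewrite !inE.
    by apply: sumr_ge0 => r _; apply: weight_ge0.
  by move: h; rewrite ler_pdivrMr ?ltr0n // mul1r ler_nat.
have [s [RR [cs cR pop]]] := popular_structure p_prime e0 Q0 fib.
have [V cV hV] := annihilator RR.
exists U, V, s; split=> //; first exact: leq_trans cU clarge.
  exact: leq_trans cV cR.
move=> x y xU yV xy.
apply: (@step3_of_orthogonal _ _ _ chi chiD chi1 chin A d e).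
- by rewrite invr_gt0 mulr_gt0 ?exprn_gt0.
- by rewrite invr_ge0 mulr_ge0 ?exprn_ge0 // ltW.
- rewrite /d /e le_eqVlt; apply/orP; left; apply/eqP; field; rewrite gt_eqF //.
- have hpow k : (N / T ^+ 2) ^+ k <= (\sum_x dens2 x) ^+ k.
    have h1 : 0 <= N / T ^+ 2 by rewrite divr_ge0 ?exprn_ge0 // ltW.
    have h2 : N / T ^+ 2 <= \sum_x dens2 x by rewrite ler_pdivrMr ?exprn_gt0 // mulrC.
    by apply: lerXn2r => //; rewrite nnegrE // (le_trans h1).
  have {}hpow : (N / T ^+ 2) ^+ 4 <= 2 * N * cor (cor dens2 dens2) (cor dens2 dens2) x.
    apply: le_trans (hpow 4%N) _.
    apply: (bogolyubov chiD chi1 chin TU0 d01) => [|r hr].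
      apply: le_trans (hpow 3%N); rewrite le_eqVlt; apply/orP; left; apply/eqP.
      by rewrite /TU; field; rewrite gt_eqF.
    by apply: hU xU _; rewrite inE.
  move: hpow.
  rewrite (_ : (N / T ^+ 2) ^+ 4 = 2 * N * (d * N ^+ 3)); last first.
    by rewrite /d; field; rewrite gt_eqF.
  by rewrite ler_pM2l // mulr_gt0.
move=> r hr; suff hp : (#|E| ^ 3 <= pop_const t * quads Gam Gam Gam Gam (x, r))%N.
  (* [r] splits into [r - x a.1], orthogonal to [V], and [x a.1], orthogonal to [y] by
     assumption. *)
  have [a sa ra] := pop x r hp.
  by rewrite -[r](subrK (x *m a.1)) dotC dotD !(dotC y) (hV _ _ yV ra) xy // addr0.
have w01 z : 0 <= weight chi A z <= 1 by rewrite weight_ge0 (weight_le1 chiD).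
have sw : \sum_z weight chi A z <= N.
  rewrite (eq_bigr (fun z => weight chi A (z.1, z.2))); last by case.
  rewrite -(pair_bigA _ (fun x r => weight chi A (x, r))) /=.
  apply: le_trans (_ : \sum_(x : E) 1 <= N); last by rewrite sumr_const.
  apply: ler_sum => z _; rewrite (sum_weight chiD chi1 chin).
  by case/andP: (density01 R A z).
have Qi0 : 0 <= Q%:R^-1 :> R by rewrite invr_ge0.
have h := le_trans hr (quads_of_weight w01 (x, r) Qi0).
rewrite -(ler_nat R) natrM natrX /pop_const natrM natrX -/T.
have h3 : (\sum_z weight chi A z) ^+ 3 <= N ^+ 3.
  rewrite lerXn2r ?nnegrE ?ler0n // sumr_ge0 // => z _; exact: weight_ge0.
have {h3}h3 : 4 * Q%:R^-1 * (\sum_z weight chi A z) ^+ 3 <= 4 * Q%:R^-1 * N ^+ 3.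
  by rewrite ler_wpM2l // mulr_ge0.
have {h3 h} := le_trans h (lerD (lexx _) h3).
rewrite -lerBlDr -mulrBl QE (_ : e - _ = (8 * T ^+ 12)^-1); last first.
  by rewrite /e; field; rewrite gt_eqF.
by rewrite ler_pdivrMl ?mulr_gt0 ?exprn_gt0 // -QE.
Qed.

End DenseSets.

(** * Sets of density above 3/4 *)

Section VeryDense.
Variable G : finZmodType.
Implicit Types (S : {set G}) (A : {set G * G}).

(** [S] and its translate by [z] each exceed half of [G], so they meet. *)
Lemma half_difference S z : (#|G| < 2 * #|S|)%N -> z \in setSub S S.
Proof.
move=> hS; pose T := [set a + z | a in S].
have cT : #|T| = #|S| by rewrite card_imset //; apply: addIr.
have : (0 < #|S :&: T|)%N.
  have h : (#|S :|: T| <= #|G|)%N := max_card _.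
  by rewrite -(ltn_add2l #|S :|: T|) cardsUI cT addn0 addnn -mul2n (leq_ltn_trans h).
case/card_gt0P => a /setIP[aS /imsetP[b bS e]].
by apply/imset2P; exists a b => //; rewrite e addrC addKr.
Qed.

(** More than half of the fibres exceed half of [G], so their difference sets are everything, and
    [half_difference] then fills the second set. This serves densities near 1, where the bound
    cannot absorb constants. *)
Lemma step3_full A x y : (3 * #|G| ^ 2 < 4 * #|A|)%N -> (x, y) \in step3 A.
Proof.
move=> hA; pose X := [set x | #|G| < 2 * #|fiber_fst A x|]%N.
have hX : (#|G| < 2 * #|X|)%N.
  have : (2 * #|A| <= #|G| ^ 2 + #|X| * #|G|)%N.
    rewrite -sum_card_fibre big_distrr -sum_indic big_distrl -mulnn -sum_nat_const -big_split /=.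
    apply: leq_sum => a _; rewrite inE; case: ltnP => h; last by rewrite mul0n addn0.
    by rewrite mul1n addnn -mul2n leq_mul2l max_card.
  by move: hA; rewrite -mulnn; nia.
have h2 a b : (a, b) \in step2 A.
  apply/bigcupP; exists b => //; rewrite in_setX set11 andbT.
  have st c : c \in X -> c \in fiber_snd (step1 A) b.
    rewrite !inE => hc; apply/bigcupP; exists c => //; rewrite in_setX set11 /=.
    exact: half_difference.
  have /imset2P[c d cX dX ->] := half_difference a hX.
  rewrite (_ : c - d = c + d - d - d); last by zmod.
  by apply: set2A2SP; apply: st.
apply/bigcupP; exists x => //; rewrite in_setX set11 /=.
have hz z : z \in fiber_fst (step2 A) x by rewrite inE.
by have := set2A2SP (hz y) (hz 0) (hz 0) (hz 0); rewrite addr0 !subr0.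
Qed.

End VeryDense.

(** * Growth of the constants and conclusion *)

Definition poly_bounded (f : nat -> nat) :=
  exists B, forall t, (1 < t)%N -> (f t <= t ^ B)%N.

Definition exp_poly_bounded (f : nat -> nat -> nat) :=
  exists B, forall p t, (1 < p)%N -> (1 < t)%N -> (f p t <= p ^ (t ^ B))%N.

Lemma poly_bounded_id : poly_bounded id.
Proof. by exists 1%N => t _; rewrite expn1. Qed.

(** Restricting to [t > 1] gives [c < 2^c <= t^c], so a power of [t] absorbs constants. *)
Lemma poly_bounded_const c : poly_bounded (fun=> c).
Proof.
exists c => t t1; apply: leq_trans (ltnW (ltn_expl c (ltnSn 1))) _.
by case: c => // c; rewrite leq_exp2r.
Qed.

Lemma poly_boundedM f g :
  poly_bounded f -> poly_bounded g -> poly_bounded (fun t => f t * g t)%N.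
Proof.
move=> [B hB] [D hD]; exists (B + D)%N => t t1.
by rewrite expnD leq_mul ?hB ?hD.
Qed.

Lemma poly_boundedX f k : poly_bounded f -> poly_bounded (fun t => f t ^ k)%N.
Proof.
move=> [B hB]; exists (B * k)%N => t t1; rewrite expnM.
by case: k => // k; rewrite leq_exp2r ?hB.
Qed.

Lemma exp_poly_boundedM f g : exp_poly_bounded f -> exp_poly_bounded g ->
  exp_poly_bounded (fun p t => f p t * g p t)%N.
Proof.
(* The exponents of [p] add up: [t^B + t^D <= 2 t^(B + D) <= t^(B + D + 1)]. *)
move=> [B hB] [D hD]; exists (B + D).+1 => p t p1 t1.
apply: leq_trans (leq_mul (hB p t p1 t1) (hD p t p1 t1)) _.
rewrite -expnD leq_exp2l // expnS.
apply: leq_trans (_ : 2 * t ^ (B + D) <= _)%N; last by rewrite leq_mul2r t1 orbT.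
by rewrite mul2n -addnn leq_add // leq_exp2l // ?leq_addr ?leq_addl.
Qed.

Lemma exp_poly_boundedX f k :
  exp_poly_bounded f -> exp_poly_bounded (fun p t => f p t ^ k)%N.
Proof.
move=> hf; elim: k => [|k IH].
  by exists 0%N => p t p1 t1; rewrite expn0 expn1 ltnW.
have [B hB] := exp_poly_boundedM hf IH.
by exists B => p t p1 t1; rewrite expnS hB.
Qed.

Lemma exp_poly_bounded_exp f :
  poly_bounded f -> exp_poly_bounded (fun p t => p ^ f t)%N.
Proof. by move=> [B hB]; exists B => p t p1 t1; rewrite leq_exp2l ?hB. Qed.

Lemma exp_poly_bounded_poly f :
  poly_bounded f -> exp_poly_bounded (fun=> f).
Proof.
move=> [B hB]; exists B => p t p1 t1; apply: leq_trans (hB t t1) _.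
exact/ltnW/ltn_expl.
Qed.

Ltac poly_bounded :=
  lazymatch goal with
  | |- poly_bounded (fun t => (@?f t * @?g t)%N) =>
      apply: (@poly_boundedM f g); poly_bounded
  | |- poly_bounded (fun t => (@?f t ^ ?k)%N) =>
      apply: (@poly_boundedX f k); poly_bounded
  | |- poly_bounded (fun t => t) => exact: poly_bounded_id
  | |- poly_bounded (fun=> ?c) => exact: (poly_bounded_const c)
  | |- _ => assumption
  end.

(** All factors are polynomial in [t] except a power of [p], whose exponent [cover_const] is
    polynomial in [t]. *)
Lemma form_const_bounded : exp_poly_bounded form_const.
Proof.
have pop : poly_bounded (fun t => pop_const t) by rewrite /pop_const; poly_bounded.
have fib : poly_bounded (fun t => fibre_const t) by rewrite /fibre_const; poly_bounded.
pose e t := small_energy_const (pop_const t) (fibre_const t).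
have sml : poly_bounded (fun t => e t) by rewrite /e /small_energy_const; poly_bounded.
pose K t := (fibre_const t ^ 3 * e t)%N.
have hK : poly_bounded (fun t => K t) by rewrite /K; poly_bounded.
have bsg : poly_bounded (fun t => bsg_const (K t)) by rewrite /bsg_const; poly_bounded.
have cov : poly_bounded (fun t => cover_const (K t)) by rewrite /cover_const; poly_bounded.
pose P t := (e t * (4 * K t) *
  (4 * fibre_const t * cover_const (K t) * bsg_const (K t)))%N.
have hP : poly_bounded (fun t => P t) by rewrite /P; poly_bounded.
have [B hB] : exp_poly_bounded (fun p t => P t * p ^ cover_const (K t) * fibre_const t)%N.
  apply: (@exp_poly_boundedM (fun p t => P t * p ^ cover_const (K t))%N
    (fun _ t => fibre_const t)); last exact: exp_poly_bounded_poly fib.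
  apply: (@exp_poly_boundedM (fun _ t => P t) (fun p t => p ^ cover_const (K t))%N).
    exact: exp_poly_bounded_poly hP.
  exact: exp_poly_bounded_exp cov.
by exists B => p t p1 t1; apply: hB.
Qed.

(** The product dominates each of the three codimension bounds, so one exponent serves them all. *)
Lemma total_const_bounded :
  exp_poly_bounded (fun p t => 2 * t ^ 6 * (2 * pop_const t * form_const p t ^ 8))%N.
Proof.
apply: (@exp_poly_boundedM (fun _ t => 2 * t ^ 6)%N
  (fun p t => 2 * pop_const t * form_const p t ^ 8)%N).
  by apply: (@exp_poly_bounded_poly (fun t => 2 * t ^ 6)%N); poly_bounded.
apply: (@exp_poly_boundedM (fun _ t => 2 * pop_const t)%N (fun p t => form_const p t ^ 8)%N).
  by apply: (@exp_poly_bounded_poly (fun t => 2 * pop_const t)%N); rewrite /pop_const; poly_bounded.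
exact: exp_poly_boundedX form_const_bounded.
Qed.

(** For this base the bound is [p] to the power [c^-(4 (B + 1))]: the exponent [B] is absorbed in
    the base, and the successor keeps the base above 1 when [B = 0]. *)
Lemma bohr_bound_ge (R : realType) (c : R) (B p t : nat) :
    (0 < p)%N -> 0 < c -> c <= 3 / 4 -> t%:R <= 2 / c ->
  (p ^ (t ^ B))%N%:R <= bohr_bound (expR (4 * B.+1)%:R^-1) 1 p c.
Proof.
move=> p0 c0 c34 tc; rewrite /bohr_bound /log_base expRK.
have c1 : 4 / 3 <= c^-1.
  by rewrite -[4 / 3]invrK lef_pV2 ?posrE ?invr_gt0 ?divr_gt0 // invf_div.
have lnc : 0 <= ln c^-1 by apply: ln_ge0; apply: le_trans c1; lra.
rewrite powRr1 ?divr_ge0 ?invr_ge0 // invrK mulrC expRM_natl lnK ?posrE ?invr_gt0 //.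
rewrite natrX -(powR_mulrn (t ^ B)) ?ler0n //; apply: ler_powR; first by rewrite ler1n.
(* Uses [2 <= (4/3)^3 <= c^-3]. *)
rewrite natrX; have t1 : (t%:R : R) <= (c^-1) ^+ 4.
  apply: le_trans tc _; rewrite exprSr ler_pM2r ?invr_gt0 //.
  apply: le_trans (_ : (4 / 3) ^+ 3 <= _); first by rewrite !exprS expr0; lra.
  have h43 : 0 <= 4 / 3 :> R by lra.
  by apply: lerXn2r; rewrite ?nnegrE // (le_trans h43).
have t2 : (t%:R : R) ^+ B <= (c^-1) ^+ 4 ^+ B by rewrite lerXn2r ?nnegrE ?exprn_ge0 // ?invr_ge0 ltW.
apply: le_trans t2 _; rewrite exprM; apply: ler_weXn2l => //.
by apply: exprn_ege1; apply: le_trans c1; lra.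
Qed.

(** Common end of both ranges of density, with the variety cut out by [graph_form]. *)
Lemma bohr_variety_of_graphs (R : realType) (p n : nat)
    (A : {set 'rV['F_p]_n * 'rV['F_p]_n}) (bound : R) (U V : {vspace 'rV['F_p]_n})
    (s : seq ('M['F_p]_n * 'rV['F_p]_n)) :
    (codim U)%:R <= bound -> (codim V)%:R <= bound -> (size s)%:R <= bound ->
    (forall x y, x \in U -> y \in V -> (forall a, a \in s -> dot (x *m a.1) y = 0) ->
      (x, y) \in step3 A) ->
  exists (U V : {vspace 'rV['F_p]_n}) (BL : {set 'rV['F_p]_n * 'rV['F_p]_n})
         (W : vectType 'F_p)
         (beta : {bilinear 'rV['F_p]_n -> 'rV['F_p]_n -> W}),
    [/\ bilinear_Bohr_variety beta BL,
        setX (vset U) (vset V) :&: BL \subset step3 A,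
        (codim U)%:R <= bound, (codim V)%:R <= bound & (\dim {:W})%:R <= bound].
Proof.
move=> hU hV hs h.
exists U, V, [set xy | graph_form s xy.1 xy.2 == 0], 'rV['F_p]_(size s), (graph_form s).
split=> //; first by split=> //; apply: graph_form_biaffine.
  apply/subsetP => -[x y]; rewrite !inE /= => /andP[/andP[xU yV] /eqP xy].
  by apply: h => //; apply: graph_form_eq0.
by rewrite dimvf /dim /= mul1n.
Qed.

Theorem theorem1 (R : realType) :
  exists b K : R, 1 < b /\ 0 < K /\
  forall (p n : nat) (A : {set 'rV['F_p]_n * 'rV['F_p]_n}) (c : R),
    prime p ->
    0 < c ->
    #|A|%:R = c * (#|{: 'rV['F_p]_n}| ^ 2)%N%:R ->
    exists (U V : {vspace 'rV['F_p]_n}) (BL : {set 'rV['F_p]_n * 'rV['F_p]_n})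
           (W : vectType 'F_p)
           (beta : {bilinear 'rV['F_p]_n -> 'rV['F_p]_n -> W}),
      [/\ bilinear_Bohr_variety beta BL,
          setX (vset U) (vset V) :&: BL \subset step3 A,
          (codim U)%:R <= bohr_bound b K p c,
          (codim V)%:R <= bohr_bound b K p c
        & (\dim {:W})%:R <= bohr_bound b K p c].
Proof.
have [B hB] := total_const_bounded.
(* The base depends only on [B], an absolute constant. *)
exists (expR (4 * B.+1)%:R^-1), 1; split; first by rewrite expR_gt1 invr_gt0 ltr0n.
split=> // p n A c p_prime c0 hA.
set bound := bohr_bound _ _ _ _.
pose N : R := #|{: 'rV['F_p]_n}|%:R.
have N0 : 0 < N by rewrite ltr0n; apply/card_gt0P; exists 0.
have hA' : #|A|%:R = c * N ^+ 2 by rewrite hA natrX.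
have [c34|c34] := leP c (3 / 4); last first.
  have b0 : 0 <= bound by apply: powR_ge0.
  (* Whole spaces and no forms: all codimensions are 0. *)
  apply: (bohr_variety_of_graphs (U := fullv) (V := fullv) (s := [::])); rewrite /codim ?subnn //= => x y _ _ _.
  apply: step3_full; rewrite -(ltr_nat R) (natrM _ 3) (natrM _ 4) natrX hA' -/N.
  by have : 0 < N ^+ 2 by [apply: exprn_gt0]; nra.
have ci : 0 < c^-1 by rewrite invr_gt0.
have c1 : 1 <= c^-1 by rewrite invf_ge1 //; lra.
(* [t] exceeds [1/c], is at least 2, and is at most [2/c]. *)
pose t := (Num.truncn c^-1).+1.
have /andP[tc1 tc2] := truncn_itv (ltW ci).
have t1 : (1 < t)%N by rewrite ltnS truncn_gt0.
have tc : (t%:R : R) <= 2 / c by rewrite /t -natr1; lra.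
have tA : (#|{: 'rV['F_p]_n}| ^ 2 <= t * #|A|)%N.
  rewrite -(ler_nat R) natrM hA' natrX -/N mulrA ler_peMl ?exprn_ge0 ?ler0n //.
  by rewrite -ler_pdivrMr // div1r ltW.
have [U [V [s [cU cs cV h]]]] := bilinear_bogolyubov R p_prime (ltnW t1) tA.
have tot m : (m <= 2 * t ^ 6 * (2 * pop_const t * form_const p t ^ 8))%N -> m%:R <= bound.
  move=> hm; apply: le_trans (bohr_bound_ge B (prime_gt0 p_prime) c0 c34 tc).
  by rewrite ler_nat (leq_trans hm) // hB // prime_gt1.
have t0 : (0 < t)%N by [].
have e0 : (0 < pop_const t)%N by rewrite muln_gt0 expn_gt0 t0.
have f0 : (0 < form_const p t)%N.
  rewrite /form_const /graphs_const /agree_const /small_energy_const /fibre_const.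
  by rewrite /cover_const /bsg_const !(muln_gt0, expn_gt0) t0 (prime_gt0 p_prime).
have f8 : (form_const p t <= form_const p t ^ 8)%N by rewrite -[leqLHS]expn1 leq_pexp2l.
have t6 : (0 < 2 * t ^ 6)%N by rewrite muln_gt0 expn_gt0 t0.
have e2 : (0 < 2 * pop_const t)%N by rewrite muln_gt0 e0.
apply: (bohr_variety_of_graphs (U := U) (V := V) (s := s)) => //; apply: tot.
- by apply: leq_trans cU _; rewrite leq_pmulr // muln_gt0 e2 expn_gt0 f0.
- apply: leq_trans cV _; rewrite -[leqLHS]mul1n leq_mul // leq_mul2l leq_exp2r // cs orbT //.
- apply: leq_trans cs _; rewrite -[leqLHS]mul1n leq_mul //.
  by rewrite -[leqLHS]mul1n leq_mul.
Qed.
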